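(* Let $\beta\in(0,1)$ and assume $\dim\mathcal H\ge 2$. For $\xi\in\mathcal N$ let $(I_n(\xi))_{n\in\mathbb N_0}$ be the unique system of functions on $\mathcal N'$ such that $I_n(\xi)=p_{n,\xi}(\langle\cdot,\xi\rangle)$ for some monic polynomial $p_{n,\xi}$ of degree $n$, and $I_n(\xi)\perp I_m(\xi)$ in $L^2(\mu_\beta)$ for all $n\ne m$. Then there exist $n\neq m$ and $\xi,\zeta\in\mathcal N$, orthogonality being understood in $L^2(\mu_\beta)$, such that $I_n(\xi)\not\perp I_m(\zeta)$.
   Context: Nuclear triple: $\mathcal H$ is a real separable Hilbert space with inner product $(\cdot,\cdot)$ and norm $|\cdot|=|\cdot|_0$. For $p\in\mathbb N_0$, $\mathcal H_p$ is a real separable Hilbert space with norm $|\cdot|_p$, $\mathcal H_0=\mathcal H$, with continuous dense Hilbert–Schmidt inclusions $\mathcal H_{p+1}\subset\mathcal H_p$ and $|\cdot|_p\le|\cdot|_{p+1}$ on $\mathcal H_{p+1}$. $\mathcal N=\bigcap_p\mathcal H_p$ with the projective limit topology is a nuclear space, continuously and densely embedded in $\mathcal H$; $\mathcal N'$ is its dual, $\langle\cdot,\cdot\rangle$ is the dual pairing between $\mathcal N'$ and $\mathcal N$, and with $\mathcal H$ identified with its dual, $\mathcal N\subset\mathcal H\subset\mathcal N'$ and $\langle f,\varphi\rangle=(f,\varphi)$ for $f\in\mathcal H,\varphi\in\mathcal N$. Mittag-Leffler function: $\mathrm E_\beta(z)=\sum_{n\ge0}z^n/\Gamma(\beta n+1)$,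 $z\in\mathbb C$. Mittag-Leffler measure: for $\beta\in(0,1]$, $\mu_\beta$ is the unique probability measure on $\mathcal N'$ with its cylinder $\sigma$-algebra such that $\int_{\mathcal N'}\exp(i\langle\omega,\varphi\rangle)\,d\mu_\beta(\omega)=\mathrm E_\beta(-\tfrac12\langle\varphi,\varphi\rangle)$ for all $\varphi\in\mathcal N$. $L^2(\mu_\beta)=L^2(\mathcal N',\mu_\beta;\mathbb C)$. The functions $I_n(\xi)$ exist and are uniquely determined for every $\xi\in\mathcal N$. *)

(* Defs.v *)
From HB Require Import structures.
From mathcomp Require Import all_boot all_order all_algebra sesquilinear.
From mathcomp Require Import all_classical all_reals all_analysis.
From mathcomp Require Import complex.

Set Implicit Arguments.
Unset Strict Implicit.
Unset Printing Implicit Defensive.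

Import Order.TTheory GRing.Theory Num.Theory.
Import numFieldNormedType.Exports.

Local Open Scope classical_set_scope.
Local Open Scope ring_scope.

Definition separable (T : topologicalType) : Prop :=
  exists2 A : set T, countable A & dense A.

Definition dim_ge2 (R : realType) (V : lmodType R) : Prop :=
  exists x y : V, forall a b : R, a *: x + b *: y = 0 -> a = 0 /\ b = 0.

(* Orthonormal bases are maximal orthonormal sets. *)
Definition orthonormal_basis (R : realType) (V : lmodType R)
    (dot : {dot V for idfun}) (E : set V) : Prop :=
  (forall e f, E e -> E f -> dot e f = (e == f)%:R) /\
  (forall x, (forall e, E e -> dot x e = 0) -> x = 0).

Definition hilbert_schmidt (R : realType) (V W : normedModType R)
    (dot : {dot V for idfun}) (f : V -> W) : Prop :=
  exists2 E : set V, orthonormal_basis dot E &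
    (\esum_(e in E) (`|f e| ^+ 2)%:E < +oo)%E.

(* The spaces are separate types, so the inclusions of H_(p+1) into H_p are
   injective linear maps. *)
Record nuclear_triple (R : realType) := NuclearTriple {
  hsp : nat -> completeNormedModType R ;
  hdot : forall p, {dot (hsp p) for idfun} ;
  hdotE : forall p (x : hsp p), hdot p x x = `|x| ^+ 2 ;
  hsp_separable : forall p, separable (hsp p) ;
  incl : forall p, {linear hsp p.+1 -> hsp p} ;
  incl_inj : forall p, injective (incl p) ;
  incl_continuous : forall p, continuous (incl p) ;
  incl_dense : forall p, dense (range (incl p)) ;
  incl_hilbert_schmidt : forall p, hilbert_schmidt (hdot p.+1) (incl p) ;
  incl_norm_le : forall p (x : hsp p.+1), `|incl p x| <= `|x| }.

(* The intersection of the H_p: as the inclusions are injective, one of its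
   elements is the same thing as its family of copies in the H_p. The topology
   induced by the product of the H_p is the projective limit topology. *)
Definition threads (R : realType) (T : nuclear_triple R)
    : set (prod_topology (hsp T)) :=
  [set x | forall p, incl T p (x p.+1) = x p].
Arguments threads {R} T _.

Definition nuclear_space (R : realType) (T : nuclear_triple R) : Type :=
  threads T.

HB.instance Definition _ (R : realType) (T : nuclear_triple R) :=
  Topological.copy (nuclear_space T) (threads T).

(* The copy of an element of the nuclear space in H_p. *)
Definition component (R : realType) (T : nuclear_triple R) (p : nat)
  (phi : nuclear_space T) : hsp T p := set_val phi p.

Section NuclearSpaceLmodule.
Context {R : realType} {T : nuclear_triple R}.
Implicit Types phi psi : nuclear_space T.

Definition of_thread (x : forall p, hsp T p)
    (xP : forall p, incl T p (x p.+1) = x p) : nuclear_space T :=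
  SigSub (mem_set (xP : threads T x)).

Lemma componentP phi p : incl T p (component p.+1 phi) = component p phi.
Proof. exact: (set_valP phi). Qed.

Lemma component_of_thread x xP p : component p (@of_thread x xP) = x p.
Proof. by []. Qed.

Lemma component_inj phi psi :
  (forall p, component p phi = component p psi) -> phi = psi.
Proof. by move=> e; apply/val_inj/functional_extensionality_dep. Qed.

Let zeroP p : incl T p 0 = 0. Proof. exact: linear0. Qed.

Let oppP phi p : incl T p (- component p.+1 phi) = - component p phi.
Proof. by rewrite linearN componentP. Qed.

Let addP phi psi p : incl T p (component p.+1 phi + component p.+1 psi) =
  component p phi + component p psi.
Proof. by rewrite linearD !componentP. Qed.

Let scaleP a phi p : incl T p (a *: component p.+1 phi) = a *: component p phi.
Proof. by rewrite linearZ /= componentP. Qed.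

Let zero : nuclear_space T := of_thread zeroP.
Let opp phi : nuclear_space T := of_thread (oppP phi).
Let add phi psi : nuclear_space T := of_thread (addP phi psi).
Let scale a phi : nuclear_space T := of_thread (scaleP a phi).

Let addA : associative add.
Proof. by move=> *; apply: component_inj => p; exact: addrA. Qed.
Let addC : commutative add.
Proof. by move=> *; apply: component_inj => p; exact: addrC. Qed.
Let add0 : left_id zero add.
Proof. by move=> *; apply: component_inj => p; exact: add0r. Qed.
Let addN : left_inverse zero opp add.
Proof. by move=> *; apply: component_inj => p; exact: addNr. Qed.

HB.instance Definition _ :=
  GRing.isZmodule.Build (nuclear_space T) addA addC add0 addN.

Let scaleA a b phi : scale a (scale b phi) = scale (a * b) phi.
Proof. by apply: component_inj => p; exact: scalerA. Qed.
Let scale1 : left_id 1 scale.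
Proof. by move=> *; apply: component_inj => p; exact: scale1r. Qed.
Let scaleDr : right_distributive scale +%R.
Proof. by move=> *; apply: component_inj => p; exact: scalerDr. Qed.
Let scaleDl phi : {morph scale^~ phi : a b / a + b}.
Proof. by move=> *; apply: component_inj => p; exact: scalerDl. Qed.

HB.instance Definition _ :=
  GRing.Zmodule_isLmodule.Build R (nuclear_space T)
    scaleA scale1 scaleDr scaleDl.

Lemma component0 p : component p (0 : nuclear_space T) = 0. Proof. by []. Qed.
Lemma componentN phi p : component p (- phi) = - component p phi.
Proof. by []. Qed.
Lemma componentD phi psi p :
  component p (phi + psi) = component p phi + component p psi.
Proof. by []. Qed.
Lemma componentZ a phi p : component p (a *: phi) = a *: component p phi.
Proof. by []. Qed.

End NuclearSpaceLmodule.

Definition dual_set (R : realType) (T : nuclear_triple R)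
    : set (nuclear_space T -> R) :=
  [set f : nuclear_space T -> R | scalar f /\ continuous f].
Arguments dual_set {R} T _.

Definition dual_space (R : realType) (T : nuclear_triple R) : Type :=
  dual_set T.

HB.instance Definition _ (R : realType) (T : nuclear_triple R) :=
  Choice.copy (dual_space T) (dual_set T).

Section DualSpacePointed.
Context {R : realType} {T : nuclear_triple R}.

Let zero_dual : dual_set T (fun=> 0).
Proof.
split; first by move=> a x y; rewrite /= mulr0 addr0.
exact: cst_continuous.
Qed.

HB.instance Definition _ :=
  isPointed.Build (dual_space T) (SigSub (mem_set zero_dual)).

End DualSpacePointed.

Definition pairing (R : realType) (T : nuclear_triple R)
  (omega : dual_space T) (phi : nuclear_space T) : R := set_val omega phi.

Definition cylinders (R : realType) (T : nuclear_triple R)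
    : set (set (dual_space T)) :=
  [set A | exists (n : nat) (phi : 'I_n -> nuclear_space T)
      (B : 'I_n -> set R),
    (forall i, measurable (B i)) /\
    A = [set omega | forall i, B i (pairing omega (phi i))]].
Arguments cylinders {R} T _.

Notation dual_measurableType T := (g_sigma_algebraType (cylinders T)).

(* The pairing of phi with psi, viewed in the dual through H_0. *)
Definition pairing0 (R : realType) (T : nuclear_triple R)
  (phi psi : nuclear_space T) : R :=
  hdot T 0%N (component 0%N phi) (component 0%N psi).

Definition Gamma (R : realType) (x : R) : R :=
  \int[lebesgue_measure]_(t in `]0, +oo[) (t `^ (x - 1) * expR (- t)).

Local Open Scope complex_scope.

Definition mittag_leffler (R : realType) (beta : R) (z : R[i]) : R[i] :=
  limn (series (fun n : nat => z ^+ n / (Gamma (beta * n%:R + 1))%:C : R[i]^o)).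

Definition cexp (R : realType) (z : R[i]) : R[i] :=
  (expR (complex.Re z))%:C * (cos (complex.Im z) +i* sin (complex.Im z)).

Section ComplexL2.
Context d {X : measurableType d} {R : realType}.
Variable mu : {measure set X -> \bar R}.
Implicit Types f g : X -> R[i].

Definition cintegral f : R[i] :=
  (\int[mu]_x complex.Re (f x)) +i* (\int[mu]_x complex.Im (f x)).

Definition L2 f : Prop :=
  [/\ measurable_fun setT (fun x => complex.Re (f x)),
      measurable_fun setT (fun x => complex.Im (f x)) &
      (\int[mu]_x (complex.Re (`|f x| ^+ 2))%:E < +oo)%E].

Definition L2_inner f g : R[i] := cintegral (fun x => f x * (g x)^*).

(* L2_inner is meaningful only for f and g satisfying L2. *)
Definition L2_orthogonal f g : Prop := L2_inner f g = 0.

End ComplexL2.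

Section MittagLefflerMeasure.
Context {R : realType} {T : nuclear_triple R}.

Definition mittag_leffler_measure (beta : R)
    (mu : probability (dual_measurableType T) R) : Prop :=
  forall phi : nuclear_space T,
    cintegral mu (fun omega => cexp ('i * (pairing omega phi)%:C)) =
    mittag_leffler beta (- (2^-1 * pairing0 phi phi))%:C.

Definition monic_orthogonal_system
    (mu : probability (dual_measurableType T) R) (xi : nuclear_space T)
    (I : nat -> dual_measurableType T -> R[i]) : Prop :=
  [/\ forall n, exists p : {poly R[i]},
        [/\ p \is monic, size p = n.+1 &
            I n = fun omega => p.[(pairing omega xi)%:C]],
      forall n, L2 mu (I n) &
      forall n m, n <> m -> L2_orthogonal mu (I n) (I m)].

End MittagLefflerMeasure.

(* Main.v *)
Require Import Defs.
From HB Require Import structures.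
From mathcomp Require Import all_boot all_order all_algebra.
From mathcomp Require Import all_classical all_reals all_analysis.
From mathcomp Require Import measurable_realfun complex ring lra zify.

Set Implicit Arguments.
Unset Strict Implicit.
Unset Printing Implicit Defensive.

Import Order.TTheory GRing.Theory Num.Theory.
Import numFieldNormedType.Exports.

Local Open Scope classical_set_scope.
Local Open Scope ring_scope.
Local Open Scope complex_scope.

(** Let xi and zeta be orthonormal in H and put x = <w, xi>, y = <w, zeta>.
The claim is proved by contradiction: assume that I_n(xi) and I_m(zeta) are
orthogonal for all n <> m and all directions.

On the one hand, the characteristic function of a xi + zeta depends on a only
through a^2 + 1, so E (a x + y)^n = (a^2 + 1)^(n/2) E y^n, and the coefficient
of a^2 gives E x^2 y^(2k) = E y^(2k+2) / (2k+1) ([mixed_moment]).  On the other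
hand x^2 is a combination of I_0, I_1, I_2 in the direction xi, hence
orthogonal to every I_j(zeta) with j >= 3; this says that, tested against
polynomials in y, the function x^2 coincides with its projection al + ga y^2 on
the polynomials of degree at most 2.  Therefore
E x^2 y^(2k) = al E y^(2k) + ga E y^(2k+2) for every k.

The moments are E y^(2k) = (2k-1)!! r_k with r_k = k! / Gamma(beta k + 1), so
the two formulas combine into the recursion r_(k+1) (1 - (2k+1) ga) = al r_k,
which [no_moment_recursion] refutes.  If ga >= 1/3, the steps k = 0 and k = 1
contradict the bound (E y^2)^2 < E y^4.  If 0 < ga < 1/3, then al > 0 and the
left-hand side becomes nonpositive for large k.  If ga <= 0, then
r_(k+1) <= al r_k, so that r_k grows at most geometrically; but
Gamma(beta k + 1) <= (2^(k+1) k!)^beta makes r_k at least of the order of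
k!^(1-beta) up to a geometric factor ([Gamma_lt_fact]).  This is where beta < 1
enters: for beta = 1 the measure is Gaussian and the recursion holds, with
ga = 0 and r_k = al = 1.

Two preparations are needed.  The moments have to be read off from the
characteristic function: they are finite because every I_n is square
integrable, so the Taylor expansion of the cosine expands the characteristic
function to any order, and the coefficients of such an expansion are unique
([moments_of_expansion]).  And N has to contain orthonormal pairs: it is dense
in H by a Mittag-Leffler argument along the inclusions H_(p+1) -> H_p
([component0_dense]). *)

(** * Integrals of real functions *)

Section RealIntegrable.
Context d {X : measurableType d} {R : realType} (mu : {measure set X -> \bar R}).
Variables (D : set X) (mD : measurable D).

Lemma integrable_EFinZ (c : R) (f : X -> R) : mu.-integrable D (EFin \o f) ->
  mu.-integrable D (EFin \o (fun x => c * f x)).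
Proof. by move=> /(integrableZl mD c). Qed.

Lemma integrable_EFinD (f g : X -> R) : mu.-integrable D (EFin \o f) ->
  mu.-integrable D (EFin \o g) -> mu.-integrable D (EFin \o (fun x => f x + g x)).
Proof. by move=> intf /(integrableD mD intf). Qed.

Lemma integrable_EFinB (f g : X -> R) : mu.-integrable D (EFin \o f) ->
  mu.-integrable D (EFin \o g) -> mu.-integrable D (EFin \o (fun x => f x - g x)).
Proof. by move=> intf /(integrableB mD intf). Qed.

Lemma integrable_EFin_le (f g : X -> R) : measurable_fun D f ->
  (forall x, D x -> `|f x| <= g x) -> mu.-integrable D (EFin \o g) ->
  mu.-integrable D (EFin \o f).
Proof.
move=> mf fg; apply: le_integrable => //; first exact/measurable_EFinP.
by move=> x /fg fgx; rewrite lee_fin (le_trans fgx)// ler_norm.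
Qed.

Lemma ge0_subset_Rintegral (A : set X) (f : X -> R) : measurable A -> A `<=` D ->
  mu.-integrable D (EFin \o f) -> (forall x, D x -> 0 <= f x) ->
  \int[mu]_(x in A) f x <= \int[mu]_(x in D) f x.
Proof.
move=> mA AD intf f0; have intAf := integrableS mD mA AD intf.
rewrite /Rintegral fine_le ?integrable_fin_num//.
by apply: ge0_subset_integral => //; exact: measurable_int intf.
Qed.

End RealIntegrable.

Section ProbabilityRintegral.
Context d {X : measurableType d} {R : realType} (mu : probability X R).

Lemma Rintegral_probability_cst (c : R) : \int[mu]_x c = c.
Proof.
by rewrite Rintegral_cst// [X in fine X](_ : _ = 1%E) ?mulr1//; exact: probability_setT.
Qed.

Lemma Rintegral_sum (I : finType) (g : I -> X -> R) :
  (forall i, mu.-integrable setT (EFin \o g i)) ->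
  mu.-integrable setT (EFin \o (fun x => \sum_i g i x)) /\
  \int[mu]_x (\sum_i g i x) = \sum_i \int[mu]_x g i x.
Proof.
move=> int_g.
have int_seq (r : seq I) : mu.-integrable setT (EFin \o (fun x => \sum_(i <- r) g i x)) /\
    \int[mu]_x (\sum_(i <- r) g i x) = \sum_(i <- r) \int[mu]_x g i x.
  elim: r => [|i r [IH1 IH2]].
    rewrite big_nil; under [X in Rintegral _ _ X]eq_fun do rewrite big_nil.
    under [X in EFin \o X]eq_fun do rewrite big_nil.
    split; first exact: finite_measure_integrable_cst.
    by rewrite Rintegral_cst// mul0r.
  rewrite big_cons; under [X in Rintegral _ _ X]eq_fun do rewrite big_cons.
  under [X in EFin \o X]eq_fun do rewrite big_cons.
  split; first exact: integrable_EFinD.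
  by rewrite RintegralD// IH2.
exact: int_seq.
Qed.

End ProbabilityRintegral.

(** * Bounds on the gamma function *)

Section GammaBounds.
Context {R : realType}.
Local Notation leb := (@lebesgue_measure R).

(** A single term of the exponential series at t / 2 is bounded by its sum. *)
Lemma exprn_le_fact_expR (k : nat) (t : R) : 0 <= t ->
  t ^+ k <= 2 ^+ k * k`!%:R * expR (t / 2).
Proof.
move=> t0; have t20 : 0 <= t / 2 by rewrite divr_ge0.
have le_expR : (t / 2) ^+ k / k`!%:R <= expR (t / 2).
  have -> : (t / 2) ^+ k / k`!%:R = exp_coeff (t / 2) k by rewrite exp_coeffE mulrC.
  apply: le_trans (nondecreasing_cvgn_le _ (is_cvg_series_exp_coeff (t / 2)) k.+1).
    by rewrite seriesEnat/= big_nat_recr//= lerDr sumr_ge0// => i _; exact: exp_coeff_ge0.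
  by apply: nondecreasing_series => n _ _; exact: exp_coeff_ge0.
have fact0 : 0 < k`!%:R :> R by rewrite ltr0n fact_gt0.
rewrite ler_pdivrMr// in le_expR.
rewrite -mulrA [k`!%:R * _]mulrC -ler_pdivrMl ?exprn_gt0//.
by apply: le_trans le_expR; rewrite expr_div_n mulrC.
Qed.

(** The concave function s |-> s^b lies below its tangent at A; this is
Young's inequality for the exponents 1 / b and 1 / (1 - b). *)
Lemma powR_le_tangent (b A s : R) : 0 < b < 1 -> 0 < A -> 0 <= s ->
  s `^ b <= A `^ b * (b * (s / A) + (1 - b)).
Proof.
move=> /andP[b0 b1] A0 s0.
have sA0 : 0 <= s / A by rewrite divr_ge0// ltW.
have -> : s `^ b = A `^ b * ((s / A) `^ b).
  by rewrite -powRM// ?(ltW A0)//; congr (_ `^ _); rewrite mulrC divfK// gt_eqF.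
apply: ler_wpM2l; first exact: powR_ge0.
have b10 : 0 < 1 - b by rewrite subr_gt0.
have := @conjugate_powR R ((s / A) `^ b) 1 b^-1 (1 - b)^-1.
rewrite powR_ge0 ler01 !invr_gt0 b0 b10 !invrK [b + _]addrC subrK.
move=> /(_ isT isT isT isT erefl).
by rewrite -powRrM mulfV ?gt_eqF// powRr1// powR1 mulr1 mul1r [s / A * b]mulrC.
Qed.

Variables (b : R) (b01 : 0 < b < 1) (k : nat).

(* Substituting s = t^k in the tangent bound dominates the integrand f of
   Gamma (b k + 1) by g.  The two exponential densities have integral 1, so g
   integrates to A^b: this is Jensen's inequality for s |-> s^b and the
   exponential law, with A an upper bound of the k-th moment. *)
Let A : R := 2 ^+ k.+1 * k`!%:R.
Let f (t : R) := t `^ (b * k%:R + 1 - 1) * expR (- t).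
Let g (t : R) := A `^ b * (b * exponential_pdf 2^-1 t + (1 - b) * exponential_pdf 1 t).

Let A0 : 0 < A. Proof. by rewrite mulr_gt0 ?exprn_gt0// ltr0n fact_gt0. Qed.

Let f_ge0 t : 0 <= f t. Proof. by rewrite mulr_ge0 ?powR_ge0 ?expR_ge0. Qed.

Let le_fg t : 0 < t -> f t <= g t.
Proof.
move=> t0; have t0' := ltW t0; move/andP: (b01) => [b0 b1].
rewrite /f /g addrK mulrC mulrC [b * _]mulrC powRrM powR_mulrn//.
rewrite !exponential_pdfE//.
apply: (@le_trans _ _ (A `^ b * (b * (t ^+ k / A) + (1 - b)) * expR (- t))).
  by rewrite ler_wpM2r ?expR_ge0// powR_le_tangent// exprn_ge0.
rewrite -mulrA ler_wpM2l ?powR_ge0// mulrDl mul1r mulN1r lerD2r -mulrA ler_wpM2l ?(ltW b0)//.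
have -> : expR (- t) = expR (- (2^-1) * t) * expR (- (2^-1) * t).
  by rewrite -expRD; congr expR; field.
rewrite mulrA ler_wpM2r ?expR_ge0//.
have := exprn_le_fact_expR k t0'.
have -> : expR (t / 2) = (expR (- 2^-1 * t))^-1.
  by rewrite -expRN; congr expR; rewrite mulNr opprK mulrC.
rewrite ler_pdivlMr ?expR_gt0// => h.
by rewrite mulrAC ler_pdivrMr// (le_trans h)// /A exprS -!mulrA mulKf.
Qed.

Let mf : measurable_fun (`]0%R, +oo[%classic : set R) f.
Proof.
apply: measurable_funTS; apply: measurable_funM.
  exact: measurable_powR.
by apply: measurableT_comp => //; exact: oppr_measurable.
Qed.

Let g_ge0 t : 0 <= g t.
Proof.
move/andP: (b01) => [b0 b1].
rewrite mulr_ge0 ?powR_ge0// addr_ge0// mulr_ge0 ?exponential_pdf_ge0 ?invr_ge0//.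
  exact: ltW.
by rewrite subr_ge0 ltW.
Qed.

Let int_pdf (r : R) : 0 < r -> leb.-integrable setT (EFin \o exponential_pdf r).
Proof. exact: integrable_exponential_pdf. Qed.

Let int_g1 : leb.-integrable setT (EFin \o (fun t => b * exponential_pdf 2^-1 t)).
Proof. by apply: integrable_EFinZ => //; apply: int_pdf; rewrite invr_gt0. Qed.

Let int_g2 : leb.-integrable setT (EFin \o (fun t => (1 - b) * exponential_pdf 1 t)).
Proof. by apply: integrable_EFinZ => //; exact: int_pdf. Qed.

Let int_g12 : leb.-integrable setT
  (EFin \o (fun t => b * exponential_pdf 2^-1 t + (1 - b) * exponential_pdf 1 t)).
Proof. exact: integrable_EFinD. Qed.

Let int_g : leb.-integrable setT (EFin \o g).
Proof. exact: integrable_EFinZ. Qed.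

Let int_gD : leb.-integrable (`]0%R, +oo[%classic : set R) (EFin \o g).
Proof. by apply: (@integrableS _ _ _ leb setT _ (EFin \o g)). Qed.

Let int_f : leb.-integrable (`]0%R, +oo[%classic : set R) (EFin \o f).
Proof.
have := (@integrable_EFin_le _ _ _ leb `]0%R, +oo[%classic (measurable_itv _) f g).
apply => // t /=; rewrite in_itv/= andbT => t0.
by rewrite ger0_norm// le_fg.
Qed.

Let Rint_pdf (r : R) : 0 < r -> \int[leb]_t exponential_pdf r t = 1.
Proof. by move=> r0; rewrite /Rintegral integral_exponential_pdf. Qed.

Lemma Gamma_le_powR_fact : Gamma (b * k%:R + 1) <= (2 ^+ k.+1 * k`!%:R) `^ b.
Proof.
rewrite /Gamma -/A.
apply: (@le_trans _ _ (\int[leb]_(t in `]0%R, +oo[%classic) g t)).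
  apply: le_Rintegral => // t /=.
  by rewrite in_itv/= andbT => /le_fg.
apply: (@le_trans _ _ (\int[leb]_t g t)).
  by apply: ge0_subset_Rintegral.
rewrite RintegralZl// RintegralD// RintegralZl//; last by apply: int_pdf; rewrite invr_gt0.
rewrite RintegralZl//; last exact: int_pdf.
by rewrite !Rint_pdf ?invr_gt0// !mulr1 addrC subrK mulr1.
Qed.

(** Restrict the integral to [1, 2].  The bound serves to make the
Mittag-Leffler series converge at least for |z| < 1. *)
Lemma expRN2_le_Gamma : expR (- 2) <= Gamma (b * k%:R + 1).
Proof.
rewrite /Gamma.
have mu12 : leb (`[1%R, 2%R]%classic : set R) = 1%:E.
  rewrite lebesgue_measure_itv/= lte_fin ltr1n/= -EFinB.
  by congr EFin; ring.
have le_cst : \int[leb]_(t in `[1%R, 2%R]%classic) expR (- 2) = expR (- 2).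
  by rewrite Rintegral_cst// [X in fine X](_ : _ = 1%:E)// mulr1.
have sub : (`[1%R, 2%R]%classic : set R) `<=` `]0%R, +oo[%classic.
  by move=> t /=; rewrite !in_itv/= andbT => /andP[t1 _]; exact: lt_le_trans t1.
rewrite -le_cst.
have int_f12 : leb.-integrable (`[1%R, 2%R]%classic : set R) (EFin \o f).
  by apply: (@integrableS _ _ _ leb `]0%R, +oo[%classic).
have f_ge t : `[1%R, 2%R]%classic t -> expR (- 2) <= f t.
  rewrite /= in_itv/= => /andP[t1 t2].
  rewrite -[leLHS]mul1r; apply: ler_pM => //; rewrite ?expR_ge0//.
    rewrite addrK -[leLHS](powRr0 t) ler_powR// mulr_ge0//.
    by case/andP: b01 => /ltW.
  by rewrite ler_expR lerN2.
apply: (@le_trans _ _ (\int[leb]_(t in `[1%R, 2%R]%classic) f t)); last first.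
  by apply: ge0_subset_Rintegral.
apply: le_Rintegral => //.
have := @integrable_EFin_le _ _ _ leb `[1%R, 2%R]%classic (measurable_itv _) (cst (expR (- 2))) f.
by apply => // t t12; rewrite ger0_norm ?expR_ge0// f_ge.
Qed.

Lemma Gamma_gt0 : 0 < Gamma (b * k%:R + 1).
Proof. by apply: lt_le_trans expRN2_le_Gamma; rewrite expR_gt0. Qed.

End GammaBounds.

(** Otherwise k! <= a^k (2^(k+1) k!)^b for all k, that is,
k!^(1-b) <= 2 (2a)^k, and k! would grow only geometrically, whereas
C^k / k! tends to 0. *)
Lemma Gamma_lt_fact (R : realType) (b a : R) : 0 < b < 1 -> 0 < a ->
  exists k, a ^+ k * Gamma (b * k%:R + 1) < k`!%:R.
Proof.
move=> b01 a0; apply: contrapT => /forallNP fact_le.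
have {}fact_le k : k`!%:R <= a ^+ k * (2 ^+ k.+1 * k`!%:R) `^ b.
  have /negP := fact_le k; rewrite -leNgt => /le_trans; apply.
  by rewrite ler_wpM2l ?exprn_ge0 ?(ltW a0)// Gamma_le_powR_fact.
have /andP[b0 b1] := b01.
have b10 : 0 < 1 - b by rewrite subr_gt0.
pose c := (1 - b)^-1; pose C := (2 * a) `^ c.
have c0 : 0 <= c by rewrite invr_ge0 ltW.
have a20 : 0 <= 2 * a by rewrite mulr_ge0// ltW.
have fact_le_geo k : k`!%:R <= 2 `^ c * C ^+ k.
  have fact0 : 0 < k`!%:R :> R by rewrite ltr0n fact_gt0.
  have fact_ge0 := ltW fact0.
  have ak0 : 0 <= a ^+ k by rewrite exprn_ge0// ltW.
  have : (k`!%:R : R) `^ (1 - b) <= 2 * (2 * a) ^+ k.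
    rewrite powRB ?gt_eqF ?implybT// powRr1// ler_pdivrMr ?powR_gt0//.
    apply: le_trans (fact_le k) _.
    rewrite powRM// mulrA ler_wpM2r ?powR_ge0//.
    rewrite exprMn mulrA -exprS mulrC ler_wpM2r//.
    by rewrite -[leRHS]powRr1 ?exprn_ge0// ler_powR ?(ltW b1)// exprn_ege1// ler1n.
  move=> /(@ge0_ler_powR _ c c0 _ _ _ _).
  rewrite !nnegrE powR_ge0 mulr_ge0 ?exprn_ge0//.
  move=> /(_ isT isT); rewrite -powRrM mulfV ?gt_eqF// powRr1//.
  rewrite powRM ?exprn_ge0//.
  by rewrite -powR_mulrn// powRAC powR_mulrn ?powR_ge0.
have := cvg_exp_coeff C => /cvgrPdist_lt/(_ (2 `^ c)^-1).
rewrite invr_gt0 powR_gt0// => /(_ isT)[k _ /(_ k (leqnn _))].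
rewrite /= sub0r normrN ger0_norm ?exp_coeff_ge0 ?powR_ge0// exp_coeffE.
apply/negP; rewrite -leNgt mulrC ler_pdivlMr ?ltr0n ?fact_gt0//.
by rewrite mulrC ler_pdivrMr ?powR_gt0// mulrC.
Qed.

(** M k stands for the moment of order 2k of a unit direction.  The three
ranges of ga are excluded for different reasons: ga >= 1/3 by M 1 ^ 2 < M 2,
0 < ga < 1/3 by a change of sign for large k, and ga <= 0 by growth, since
then M j is at most al^j times the Gaussian moment (2j)! / (2^j j!). *)
Lemma no_moment_recursion (R : realType) (b : R) (M : nat -> R) (al ga : R) :
  0 < b < 1 ->
  (forall k, M k = (k.*2)`!%:R / (2 ^+ k * Gamma (b * k%:R + 1))) ->
  M 0%N = 1 -> M 1%N ^+ 2 < M 2%N ->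
  ~ (forall k, M k.+1 / k.*2.+1%:R = al * M k + ga * M k.+1).
Proof.
move=> b01 ME M0 M12 rec.
have M_gt0 k : 0 < M k.
  by rewrite ME divr_gt0// ?ltr0n ?fact_gt0// mulr_gt0 ?exprn_gt0 ?Gamma_gt0.
have recE k : M k.+1 * (1 - ga * k.*2.+1%:R) = al * k.*2.+1%:R * M k.
  have k0 : k.*2.+1%:R != 0 :> R by rewrite pnatr_eq0.
  have := rec k => /(congr1 ( *%R^~ k.*2.+1%:R)); rewrite divfK// => eqM.
  by rewrite mulrBr mulr1 [X in X - _]eqM; ring.
have M1 := M_gt0 1%N; have M2 := M_gt0 2%N.
have := recE 0%N; rewrite M0 double0 !mulr1 => rec0.
have := recE 1%N; rewrite (_ : 1.*2.+1 = 3)%N// => rec1.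
have ga3 : ga < 3^-1.
  rewrite ltNge; apply/negP => ga3.
  by have [ga1|ga1] := leP ga 1; nra.
have al0 : 0 < al by nra.
have ga0 : ga <= 0.
  rewrite leNgt; apply/negP => ga0.
  have [k] : exists k : nat, 1 <= ga * k.*2.+1%:R.
    exists (Num.truncn ga^-1).+1.
    rewrite -ler_pdivrMl// mulr1; apply: ltW; apply: lt_le_trans (truncnS_gt _) _.
    by rewrite ler_nat; move: (Num.truncn _) => t; rewrite -addnn; lia.
  move=> gak; have := recE k; apply/eqP; rewrite lt_eqF//.
  apply: (@le_lt_trans _ _ 0).
    by rewrite pmulr_rle0// subr_le0.
  by rewrite !mulr_gt0// ltr0n.
have [k] := Gamma_lt_fact b01 al0.
apply/negP; rewrite -leNgt.
have rec_le j : M j.+1 <= al * j.*2.+1%:R * M j.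
  by rewrite -recE ler_peMr// ?(ltW (M_gt0 _))// lerDl oppr_ge0 mulr_le0_ge0.
have M_le j : M j <= al ^+ j * (j.*2)`!%:R / (2 ^+ j * j`!%:R).
  elim: j => [|j IHj]; first by rewrite M0 double0 fact0; lra.
  apply: le_trans (rec_le j) _.
  have j0 : 0 <= al * j.*2.+1%:R by rewrite mulr_ge0// ltW.
  apply: le_trans (ler_wpM2l j0 IHj) _.
  rewrite doubleS !factS !exprS !natrM -muln2.
  have jn0 : j.+1%:R != 0 :> R by rewrite pnatr_eq0.
  have fn0 : j`!%:R != 0 :> R by rewrite pnatr_eq0 -lt0n fact_gt0.
  have pn0 : 2 ^+ j != 0 :> R by rewrite expf_neq0.
  rewrite le_eqVlt; apply/orP; left; apply/eqP.
  have -> : (j * 2).+2%:R = 2 * j.+1%:R :> R by rewrite -natrM [(2 * _)%N]mulnC mulSn.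
  move: jn0 fn0 pn0; move: j.+1%:R j`!%:R (2 ^+ j) (al ^+ j) (j * 2).+1%:R (j * 2)`!%:R.
  by move=> u f p q v w u0 f0 p0; field; rewrite u0 f0 p0.
have := M_le k; rewrite ME.
have f2 : 0 < (k.*2)`!%:R :> R by rewrite ltr0n fact_gt0.
have f1 : 0 < k`!%:R :> R by rewrite ltr0n fact_gt0.
have p2 : 0 < 2 ^+ k :> R by rewrite exprn_gt0.
have G0 := Gamma_gt0 b01 k.
rewrite ler_pdivrMr ?mulr_gt0// mulrAC ler_pdivlMr ?mulr_gt0// => h.
have pf : 0 < (k.*2)`!%:R * 2 ^+ k :> R by rewrite mulr_gt0.
rewrite -(ler_pM2l pf); move: h; rewrite -!mulrA => /le_trans; apply.
by rewrite le_eqVlt; apply/orP; left; apply/eqP; ring.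
Qed.

(** * Density of the nuclear space *)

(** Used both for the limits that build elements of the nuclear space and for
the tails of power series. *)
Lemma cvg_geometric_steps (R : realType) (V : completeNormedModType R)
    (v : nat -> V) (e : R) :
  0 <= e -> (forall k, `|v k.+1 - v k| <= e / 2 ^+ k.+1) ->
  exists2 l, v @ \oo --> l & `|l - v 0%N| <= e.
Proof.
move=> e0 step.
have cv_v : cvgn v.
  have -> : v = (fun n => v 0%N + series (telescope v) n).
    by apply/funext => n; rewrite -eq_sum_telescope.
  apply: is_cvgD; first exact: is_cvg_cst.
  apply: normed_cvg.
  apply: (@series_le_cvg _ _ (geometric (e / 2) 2^-1)) => [n|n|n|].
  - exact: normr_ge0.
  - by rewrite /geometric/= mulr_ge0 ?exprn_ge0 ?divr_ge0.
  - by apply: le_trans (step n) _; rewrite /geometric/= exprS invfM mulrA exprVn.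
  - by apply: is_cvg_geometric_series; rewrite ger0_norm// invf_lt1// ltr1n.
exists (limn v) => //.
have dist n : `|v n - v 0%N| <= e * (1 - 2 ^- n).
  elim: n => [|n IHn]; first by rewrite subrr normr0 expr0 invr1 subrr mulr0.
  rewrite -(subrK (v n) (v n.+1)) -addrA; apply: le_trans (ler_normD _ _) _.
  apply: le_trans (lerD (step n) IHn) _.
  rewrite le_eqVlt; apply/orP; left; apply/eqP.
  rewrite exprS invfM; set p := _ ^-1; set q := _ ^-1; rewrite /p.
  by field.
have cv_dist : `|v n - v 0%N| @[n --> \oo] --> `|limn v - v 0%N|.
  by apply: cvg_norm; apply: cvgB => //; exact: cvg_cst.
rewrite -(cvg_lim _ cv_dist)//; apply: limr_le; first by apply/cvg_ex; eexists; exact: cv_dist.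
near=> n; apply: le_trans (dist n) _.
by rewrite ler_piMr// lerBlDr lerDl invr_ge0 exprn_ge0.
Unshelve. all: by end_near. Qed.

Section Density.
Context {R : realType} (T : nuclear_triple R).

(** The composite of the inclusions H_q -> H_p for p <= q, and 0 for p > q.
Making it a total function of q and p, with a transport along q = p, avoids
spaces indexed by sums q = k + p, which are not convertible after a shift of
the index p. *)
Fixpoint down (q p : nat) : hsp T q -> hsp T p :=
  match @eqP _ q p with
  | ReflectT e => fun x => eq_rect q (hsp T) x p e
  | ReflectF _ => match q with
    | 0 => fun=> 0
    | q'.+1 => fun x => down p (Defs.incl T q' x)
    end
  end.

Lemma down_id q (x : hsp T q) : down q x = x.
Proof. by case: q x => [|q] x /=; case: eqP => // e; rewrite (eq_axiomK e). Qed.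

Lemma down_incl q p (x : hsp T q.+1) : (p <= q)%N ->
  down p x = down p (Defs.incl T q x).
Proof. by move=> pq /=; case: eqP => // e; exfalso; move: pq; rewrite -e ltnn. Qed.

Lemma incl_down q p (x : hsp T q) : (p < q)%N ->
  Defs.incl T p (down p.+1 x) = down p x.
Proof.
elim: q x => // q IHq x; rewrite ltnS leq_eqVlt => /orP[/eqP epq|pq].
  by subst p; rewrite down_id down_incl// down_id.
by rewrite down_incl// IHq// [in RHS]down_incl// ltnW.
Qed.

Lemma down_sub q p (x y : hsp T q) : (p <= q)%N ->
  down p (x - y) = down p x - down p y.
Proof.
elim: q x y => [|q IHq] x y.
  by rewrite leqn0 => /eqP ?; subst p; rewrite !down_id.
rewrite leq_eqVlt => /orP[/eqP epq|pq]; first by subst p; rewrite !down_id.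
by rewrite !down_incl// linearB IHq.
Qed.

Lemma norm_down_le q p (x : hsp T q) : (p <= q)%N -> `|down p x| <= `|x|.
Proof.
elim: q x => [|q IHq] x.
  by rewrite leqn0 => /eqP ?; subst p; rewrite down_id.
rewrite leq_eqVlt => /orP[/eqP epq|pq]; first by subst p; rewrite down_id.
rewrite down_incl//; apply: le_trans (IHq _ _) _ => //; exact: incl_norm_le.
Qed.

Lemma incl_approx p (y : hsp T p) (e : R) : 0 < e ->
  exists z : hsp T p.+1, `|Defs.incl T p z - y| < e.
Proof.
move=> e0; have [] := @incl_dense _ T p (ball y e).
- by exists y; exact: ballxx.
- exact: ball_open.
- by move=> w [yw [z _ zw]]; exists z; rewrite zw distrC; move: yw; rewrite -ball_normE.
Qed.

(** A Mittag-Leffler argument: starting from x_0, choose x_(q+1) in H_(q+1) at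
distance at most e / 2^(q+1) of x_q in H_q.  As the inclusions do not increase
norms, the images of x_q in each H_p converge as q grows; by continuity of the
inclusions their limits form a thread, and its component in H_0 is within e of
x_0. *)
Lemma component0_dense (x0 : hsp T 0) (e : R) : 0 < e ->
  exists phi : nuclear_space T, `|component 0 phi - x0| <= e.
Proof.
move=> e0.
have e2 q : 0 < e / 2 ^+ q.+1 by rewrite divr_gt0 ?exprn_gt0.
pose next q y := projT1 (cid (@incl_approx q y _ (e2 q))).
have nextP q y : `|Defs.incl T q (next q y) - y| <= e / 2 ^+ q.+1.
  by rewrite /next; case: cid => z /= /ltW.
pose x := nat_rect (hsp T) x0 next.
pose v p k := down p (x (k + p)%N).
have step p k : `|v p k.+1 - v p k| <= e / 2 ^+ p / 2 ^+ k.+1.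
  rewrite /v addSn down_incl ?leq_addl// -down_sub ?leq_addl//.
  apply: le_trans (norm_down_le _ (leq_addl _ _)) _.
  by apply: le_trans (nextP _ _) _; rewrite -addSn exprD invfM mulrAC mulrA.
have e2' p : 0 <= e / 2 ^+ p by rewrite divr_ge0 ?exprn_ge0// ltW.
pose lim_v p := cid2 (cvg_geometric_steps (e2' p) (step p)).
pose y p := s2val (lim_v p).
have cv_y p : v p @ \oo --> y p by rewrite /y; case: (lim_v p).
have yP p : Defs.incl T p (y p.+1) = y p.
  have cv1 : Defs.incl T p (v p.+1 k) @[k --> \oo] --> Defs.incl T p (y p.+1).
    by apply: continuous_cvg (cv_y p.+1); exact: incl_continuous.
  have cv2 : v p k.+1 @[k --> \oo] --> y p.
    by rewrite (cvg_shiftS (v p)); exact: cv_y.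
  apply: (cvg_unique (@norm_hausdorff _ _) cv1).
  rewrite (_ : (fun k => Defs.incl T p (v p.+1 k)) = (fun k => v p k.+1))//.
  apply/funext => k; rewrite /v incl_down; last by rewrite addnS ltnS leq_addl.
  by rewrite addnS.
exists (of_thread yP); rewrite component_of_thread.
have := s2valP' (lim_v 0%N); rewrite -/(y 0%N) /v.
by rewrite expr0 divr1 down_id.
Qed.

Lemma hdotC p (x y : hsp T p) : hdot T p x y = hdot T p y x.
Proof. by rewrite hermC expr0 mul1r. Qed.

Lemma hdotZl p a (x y : hsp T p) : hdot T p (a *: x) y = a * hdot T p x y.
Proof. exact: linearZl_LR. Qed.

Lemma hdotBl p (x y z : hsp T p) :
  hdot T p (x - y) z = hdot T p x z - hdot T p y z.
Proof. exact: linearBl. Qed.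

Lemma pairing0C (f g : nuclear_space T) : pairing0 f g = pairing0 g f.
Proof. exact: hdotC. Qed.

Lemma pairing0Dl (f g h : nuclear_space T) :
  pairing0 (f + g) h = pairing0 f h + pairing0 g h.
Proof. by rewrite /pairing0 componentD linearDl. Qed.

Lemma pairing0Zl (a : R) (f g : nuclear_space T) :
  pairing0 (a *: f) g = a * pairing0 f g.
Proof. by rewrite /pairing0 componentZ hdotZl. Qed.

(** If all of N projected to a line c of H, the continuous map
f u = (c, c) u - (u, c) c, which is a multiple of the component of u
orthogonal to c, would vanish on a dense set, hence on H, and H would have
dimension at most 1.  So f is nonzero at some psi in N, and Gram-Schmidt
applies to phi and psi. *)
Lemma exists_orthonormal_pair : dim_ge2 (hsp T 0) ->
  exists xi zeta : nuclear_space T,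
    [/\ pairing0 xi xi = 1, pairing0 zeta zeta = 1 & pairing0 xi zeta = 0].
Proof.
move=> [x [y xy_free]].
have dot_gt0 (phi : nuclear_space T) : component 0 phi != 0 -> 0 < pairing0 phi phi.
  by move=> phi0; rewrite /pairing0 hdotE exprn_gt0// normr_gt0.
pose normalize (phi : nuclear_space T) := (Num.sqrt (pairing0 phi phi))^-1 *: phi.
have normalizeP phi : 0 < pairing0 phi phi -> pairing0 (normalize phi) (normalize phi) = 1.
  move=> phi0; rewrite pairing0Zl pairing0C pairing0Zl mulrA -invfM -expr2 sqr_sqrtr ?ltW//.
  by rewrite mulVf// gt_eqF.
have x_neq0 : x != 0.
  apply/eqP => x0; have [] := xy_free 1 0; first by rewrite x0 scaler0 scale0r addr0.
  by move=> /eqP; rewrite oner_eq0.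
have [phi phi_gt0] : exists phi : nuclear_space T, 0 < pairing0 phi phi.
  have x20 : 0 < `|x| / 2 by rewrite divr_gt0// normr_gt0.
  have [phi le_phi] := component0_dense x x20.
  exists phi; apply: dot_gt0; apply: contraTneq le_phi => ->.
  by rewrite sub0r normrN -ltNge ltr_pdivrMr// ltr_pMr ?normr_gt0// ltr1n.
pose c := component 0 phi.
pose a := pairing0 phi phi.
pose f (u : hsp T 0) := a *: u - hdot T 0%N u c *: c.
have [f0|] := pselect (forall psi, f (component 0 psi) = 0); last first.
  move/existsNP => [psi /eqP fpsi].
  pose psi' := a *: psi - pairing0 psi phi *: phi.
  have psi'_gt0 : 0 < pairing0 psi' psi' by apply: dot_gt0.
  exists (normalize phi), (normalize psi'); split; [exact: normalizeP..|].
  rewrite pairing0Zl pairing0C pairing0Zl; suff -> : pairing0 psi' phi = 0 by rewrite !mulr0.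
  by rewrite pairing0Dl -scaleNr !pairing0Zl mulNr mulrC subrr.
exfalso.
have hdot_le u : hdot T 0%N u c ^+ 2 <= `|u| ^+ 2 * a.
  have := sqr_ge0 `|f u|; rewrite -hdotE /f.
  rewrite hdotBl ![hdot T 0%N _ (_ - _)]hdotC !hdotBl !hdotZl.
  rewrite ![hdot T 0%N _ (_ *: _)]hdotC !hdotZl (hdotC c u) !hdotE.
  have -> : `|c| ^+ 2 = a by rewrite -hdotE.
  (* b times the Cauchy-Schwarz defect s b - t^2 is the squared norm of f u *)
  have discr (t s b : R) : 0 < b ->
      0 <= b * (b * s) - t * (b * t) - (b * (t * t) - t * (t * b)) -> t ^+ 2 <= s * b.
    move=> b0 h; have : 0 <= b * (s * b - t ^+ 2) by move: h; nra.
    by rewrite pmulr_rge0// subr_ge0.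
  exact: discr.
have f_eq0 u : f u = 0.
  apply/eqP; rewrite -normr_eq0 eq_le normr_ge0 andbT; apply/ler_addgt0Pr => e e0.
  rewrite add0r.
  have a0 : 0 < a by [].
  have ea : 0 < e / (2 * a) by rewrite divr_gt0// mulr_gt0.
  have [psi psi_u] := component0_dense u ea.
  rewrite -normrN; have -> : - f u = f (component 0 psi - u).
    have -> : f (component 0 psi - u) = f (component 0 psi) - f u.
      by rewrite /f scalerBr linearBl scalerBl opprD opprK addrACA opprB [- _ + _]addrC.
    by rewrite f0 sub0r.
  move: (component 0 psi - u) psi_u => w w_le; rewrite /f.
  apply: le_trans (ler_normB _ _) _; rewrite !normrZ (gtr0_norm a0).
  have hw : `|hdot T 0%N w c| * `|c| <= a * `|w|.
    rewrite -(@ler_pXn2r _ 2) ?nnegrE ?mulr_ge0 ?(ltW a0)//.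
    rewrite !exprMn real_normK ?num_real// -[`|c| ^+ 2]hdotE -/(pairing0 phi phi) -/a.
    by apply: le_trans (ler_wpM2r (ltW a0) (hdot_le w)) _; rewrite mulrAC -mulrA mulrC -expr2 mulrA.
  apply: (@le_trans _ _ (2 * a * `|w|)); first by move: hw; lra.
  by rewrite -ler_pdivlMl ?mulr_gt0// mulrC.
have fx := f_eq0 x; have fy := f_eq0 y.
have a_neq0 : a != 0 by rewrite gt_eqF.
have [] := xy_free (hdot T 0%N y c * a) (- (hdot T 0%N x c * a)).
  move/eqP: fx; rewrite subr_eq0 => /eqP fx; move/eqP: fy; rewrite subr_eq0 => /eqP fy.
  by rewrite scaleNr -!scalerA fx fy !scalerA [_ * hdot T 0%N x c]mulrC subrr.
move=> _ /eqP; rewrite oppr_eq0 mulf_eq0 (negPf a_neq0) orbF => /eqP xc0.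
move: fx; rewrite /f xc0 scale0r subr0 => /eqP.
by rewrite scaler_eq0 (negPf a_neq0) (negPf x_neq0).
Qed.

End Density.

(** * Moments and expansions of the characteristic function *)

Section CosTaylor.
Context {R : realType}.

(** The mean value theorem; the constant is not sharp, as no factorials are
needed for an expansion to a given order. *)
Lemma ler_norm_derive_pow (f g : R -> R) (n : nat) :
  (forall x, is_derive x (1 : R) f (g x)) -> f 0 = 0 ->
  (forall x, `|g x| <= `|x| ^+ n) -> forall x, `|f x| <= `|x| ^+ n.+1.
Proof.
move=> fg f0 gn x.
have cf (D : set R) : {within D, continuous f}.
  by apply: continuous_subspaceT => y; apply/differentiable_continuous/derivable1_diffP/ex_derive.
have [c [cx fc]] : exists c, `|c| <= `|x| /\ f x = g c * x.
  have [x0|x0] := leP 0 x.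
    have [c] := MVT_segment x0 (fun y _ => fg y) (cf _).
    rewrite in_itv/= => /andP[c0 cx]; rewrite f0 !subr0 => fc.
    by exists c; rewrite !ger0_norm.
  have [c] := MVT_segment (ltW x0) (fun y _ => fg y) (cf _).
  rewrite in_itv/= => /andP[xc c0]; rewrite f0 !sub0r mulrN => /oppr_inj fc.
  by exists c; rewrite !ler0_norm ?(ltW x0)// lerN2.
rewrite fc normrM exprSr ler_wpM2r//.
by apply: le_trans (gn c) _; rewrite lerXn2r ?nnegrE.
Qed.

(** The Taylor polynomial of x |-> cos (x + th) at 0.  Keeping the phase th
as a parameter treats the cosine and the sine at once and makes the
derivative a polynomial of the same family. *)
Definition cos_taylor (th : R) (n : nat) : {poly R} :=
  \poly_(k < n) (cos (th + (pi / 2) *+ k) / k`!%:R).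

Lemma deriv_cos_taylor th n :
  (cos_taylor th n.+1)^`() = cos_taylor (th + pi / 2) n.
Proof.
apply/polyP => k; rewrite coef_deriv !coef_poly ltnS; case: ifP => _; last by rewrite mul0rn.
have k0 : k.+1%:R != 0 :> R by rewrite pnatr_eq0.
have f0 : k`!%:R != 0 :> R by rewrite pnatr_eq0 -lt0n fact_gt0.
rewrite [(pi / 2) *+ _]mulrS addrA factS natrM -[LHS]mulr_natr.
by move: (cos _) k.+1%:R k`!%:R k0 f0 => c u v u0 v0; field; rewrite u0 v0.
Qed.

Lemma cos_taylor_le n th x : `|cos (x + th) - (cos_taylor th n).[x]| <= `|x| ^+ n.
Proof.
elim: n th x => [|n IHn] th.
  move=> x; rewrite /cos_taylor poly_def big_ord0 horner0 subr0 expr0.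
  by rewrite ler_norml cos_geN1 cos_le1.
pose g x := cos (x + (th + pi / 2)) - (cos_taylor (th + pi / 2) n).[x].
apply: (@ler_norm_derive_pow _ g) => [x||x]; last exact: IHn.
  rewrite /g -deriv_cos_taylor addrA cosDpihalf.
  apply: (@is_deriveB _ _ _ (cos \o (fun y => y + th)) (horner (cos_taylor th n.+1))).
  have -> : - sin (x + th) = - sin (x + th) * 1 by rewrite mulr1.
  apply: is_derive1_comp.
  rewrite -[X in is_derive _ _ _ X]addr0.
  exact: (@is_deriveD _ _ _ id (cst th)).
by rewrite add0r horner_coef0 coef_poly/= mulr0n addr0 fact0 divr1 subrr.
Qed.

End CosTaylor.

(** A polynomial of degree less than n which is O(s^n) at 0 vanishes: its
constant term is 0 by continuity, and dividing by X lowers n by one. *)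
Lemma poly_bigO_eq0 (R : realType) (n : nat) (p : {poly R}) (C r : R) :
  (size p <= n)%N -> 0 < r ->
  (forall s, 0 < s < r -> `|p.[s]| <= C * s ^+ n) -> p = 0.
Proof.
move=> + r0; elim: n p => [|n IHn] p; first by rewrite leqn0 size_poly_eq0 => /eqP.
move=> sp hp.
have p0 : p.[0] = 0.
  apply/eqP; rewrite -normr_eq0 eq_le normr_ge0 andbT; apply/ler_addgt0Pr => e e0.
  rewrite add0r.
  have e20 : 0 < e / 2 by rewrite divr_gt0.
  have cp : p.[s] @[s --> 0^'+] --> p.[0].
    apply: cvg_at_right_filter; apply: differentiable_continuous.
    exact/derivable1_diffP/derivable_horner.
  have C0 : 0 < `|C| + 1 by rewrite ltr_wpDl.
  near (0 : R)^'+ => s.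
  have s0 : 0 < s by near: s; exact: nbhs_right_gt.
  have s1 : s < 1 by near: s; exact: nbhs_right_lt.
  have sr : s < r by near: s; exact: nbhs_right_lt.
  have sC : s < e / 2 / (`|C| + 1) by near: s; apply: nbhs_right_lt; rewrite divr_gt0.
  have ps : `|p.[0] - p.[s]| < e / 2 by near: s; move/cvgrPdist_lt : cp; exact.
  have := hp s; rewrite s0 sr => /(_ isT) hps.
  have : C * s ^+ n.+1 <= e / 2.
    apply: (@le_trans _ _ ((`|C| + 1) * s)); last first.
      by rewrite -ler_pdivlMl// mulrC ltW.
    apply: (@le_trans _ _ (`|C| * s ^+ n.+1)).
      by rewrite ler_wpM2r ?exprn_ge0 ?ler_norm// ltW.
    apply: ler_pM => //; rewrite ?exprn_ge0 ?(ltW s0)//.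
      by rewrite lerDl.
    by rewrite exprS ler_piMr ?(ltW s0)// exprn_ile1 ?(ltW s0)// ltW.
  move=> Cs; rewrite -(subrK p.[s] p.[0]); apply: le_trans (ler_normD _ _) _.
  by rewrite (splitr e) lerD ?(ltW ps)// (le_trans hps).
have [q pq] : exists q, p = q * 'X.
  have /factor_theorem[q] : root p 0 by rewrite /root p0.
  by rewrite subr0 => pq; exists q.
have [q_eq0|q0] := eqVneq q 0; first by rewrite pq q_eq0 mul0r.
exfalso; have /eqP := q0; apply; apply: IHn.
  by move: sp; rewrite pq size_mulX.
move=> s /andP[s0 sr]; have := hp s; rewrite s0 sr => /(_ isT).
rewrite pq hornerM hornerX normrM (gtr0_norm s0) exprSr mulrA.
by rewrite ler_pM2r.
Unshelve. all: by end_near. Qed.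

Section Moments.
Context d {X : measurableType d} {R : realType} (mu : probability X R).
Variables (f : X -> R) (mf : measurable_fun setT f).
Hypothesis int_f : forall k, mu.-integrable setT (EFin \o (fun x => f x ^+ k)).

Lemma integrable_cos (s th : R) : mu.-integrable setT (EFin \o (fun x => cos (s * f x + th))).
Proof.
apply: (@integrable_EFin_le _ _ _ mu setT measurableT _ (cst 1)).
- apply: measurableT_comp; first exact: (continuous_measurable_fun (@continuous_cos R)).
  by apply: measurable_funD => //; exact: measurable_funM.
- by move=> x _; rewrite ler_norml cos_geN1 cos_le1.
- exact: finite_measure_integrable_cst.
Qed.

Lemma integrable_norm_expr k : mu.-integrable setT (EFin \o (fun x => `|f x| ^+ k)).
Proof.
apply: (@integrable_EFin_le _ _ _ mu setT measurableT _ (fun x => 1 + f x ^+ k.*2)).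
- by apply: measurable_funX; exact: measurableT_comp.
- move=> x _; rewrite ger0_norm ?exprn_ge0// -muln2 exprM.
  rewrite -[f x ^+ k ^+ 2]real_normK ?num_real// normrX.
  by have := sqr_ge0 (`|f x| ^+ k - 1); have := exprn_ge0 k (normr_ge0 (f x)); nra.
- by apply: integrable_EFinD => //; exact: finite_measure_integrable_cst.
Qed.

(** Since all moments of f are finite, integrating the Taylor polynomial of
the cosine gives another expansion of E cos (s f + th) in powers of s, with
error at most s^n E |f|^n; the two expansions have the same coefficients.
The phase th = 0 gives the even moments and th = - pi / 2 the odd ones. *)
Lemma moments_of_expansion (th : R) (b : nat -> R) :
  (forall N, exists C r, 0 < r /\ forall s, 0 < s < r ->
     `|\int[mu]_x cos (s * f x + th) - \sum_(k < N.*2) b k * s ^+ k| <= C * s ^+ N.*2) ->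
  forall k, cos (th + (pi / 2) *+ k) / k`!%:R * \int[mu]_x (f x ^+ k) = b k.
Proof.
move=> exp_b k.
have [C [r [r0 hC]]] := exp_b k.+1.
pose n := k.+1.*2.
pose c j := cos (th + (pi / 2) *+ j) / j`!%:R.
pose m j := \int[mu]_x (f x ^+ j).
pose p : {poly R} := \poly_(j < n) (c j * m j - b j).
suff p0 : p = 0.
  have := congr1 (fun q : {poly R} => q`_k) p0; rewrite coef_poly coef0 /n.
  rewrite (leq_trans (ltnSn k)) ?leq_double -?addnn ?leq_addr// => /eqP.
  by rewrite subr_eq0 => /eqP.
pose K := \int[mu]_x (`|f x| ^+ n).
apply: (@poly_bigO_eq0 _ n p (K + C) r) => //; first exact: size_poly.
move=> s sr; have /andP[s0 _] := sr.
have taylorE x : (cos_taylor th n).[s * f x] = \sum_(j < n) c j * s ^+ j * f x ^+ j.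
  by rewrite /cos_taylor horner_poly; apply: eq_bigr => j _; rewrite exprMn mulrA.
have int_term (j : 'I_n) : mu.-integrable setT (EFin \o (fun x => c j * s ^+ j * f x ^+ j)).
  exact: integrable_EFinZ.
have [int_T T_E] := Rintegral_sum int_term.
have pE : p.[s] = \int[mu]_x (\sum_(j < n) c j * s ^+ j * f x ^+ j) - \sum_(j < n) b j * s ^+ j.
  rewrite T_E /p horner_poly -sumrB; apply: eq_bigr => j _.
  by rewrite RintegralZl// mulrBl mulrAC.
have -> : p.[s] = (\int[mu]_x cos (s * f x + th) - \sum_(j < n) b j * s ^+ j) -
   \int[mu]_x (cos (s * f x + th) - \sum_(j < n) c j * s ^+ j * f x ^+ j).
  rewrite RintegralB//; last exact: integrable_cos.
  by rewrite pE; ring.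
apply: le_trans (ler_normB _ _) _; rewrite addrC mulrDl; apply: lerD; last exact: hC.
have int_cT : mu.-integrable setT (EFin \o
    (fun x => cos (s * f x + th) - \sum_(j < n) c j * s ^+ j * f x ^+ j)).
  by apply: integrable_EFinB => //; exact: integrable_cos.
have le_cT x : `|cos (s * f x + th) - \sum_(j < n) c j * s ^+ j * f x ^+ j| <= s ^+ n * `|f x| ^+ n.
  rewrite -taylorE; apply: le_trans (cos_taylor_le _ _ _) _.
  by rewrite normrM exprMn (gtr0_norm s0).
have int_K := integrable_norm_expr n.
have int_sK : mu.-integrable setT (EFin \o (fun x => s ^+ n * `|f x| ^+ n)).
  exact: integrable_EFinZ.
apply: le_trans (le_normr_Rintegral _ _) _ => //.
rewrite mulrC -RintegralZl//; apply: le_Rintegral => //.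
apply: (@integrable_EFin_le _ _ _ mu setT measurableT _ _ _ _ int_sK).
  by apply: measurableT_comp => //; apply/measurable_EFinP/(measurable_int mu).
by move=> x _; rewrite normr_id.
Qed.

End Moments.

(** * Moments of the Mittag-Leffler measure *)

(** The partial sums from N on move by steps at most E |z|^N 2^(-k), which is
why the restriction to |z| <= 1/2 gives an error bound for every N at once. *)
Lemma power_series_tail (R : realType) (c : nat -> R) (E z : R) :
  (forall j, `|c j| <= E) -> `|z| <= 2^-1 ->
  exists2 l, series (fun n => c n * z ^+ n) @ \oo --> l &
    forall N, `|l - \sum_(j < N) c j * z ^+ j| <= 2 * E * `|z| ^+ N.
Proof.
move=> cE z2; have E0 : 0 <= E by apply: le_trans (cE 0%N).
have tail N : exists2 l, series (fun n => c n * z ^+ n) (n + N)%N @[n --> \oo] --> l &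
    `|l - \sum_(j < N) c j * z ^+ j| <= 2 * E * `|z| ^+ N.
  have e0 : 0 <= 2 * E * `|z| ^+ N by rewrite !mulr_ge0 ?exprn_ge0.
  have [k|l cvl ll] := @cvg_geometric_steps R R
      (fun n => series (fun n => c n * z ^+ n) (n + N)%N) _ e0.
    rewrite seriesEnat/= addSn big_nat_recr//= addrAC subrr add0r.
    have -> : 2 * E * `|z| ^+ N / 2 ^+ k.+1 = E * (2 ^- k * `|z| ^+ N).
      have pk : 2 ^+ k != 0 :> R by rewrite expf_neq0.
      by rewrite exprS; move: (2 ^+ k) (`|z| ^+ N) pk => p q p0; field.
    rewrite normrM normrX exprD; apply: ler_pM; rewrite ?mulr_ge0 ?exprn_ge0//.
    by rewrite ler_wpM2r ?exprn_ge0// -exprVn lerXn2r ?nnegrE.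
  by exists l => //; move: ll; rewrite seriesEnat/= add0n big_mkord.
have [l cvl _] := tail 0%N.
have cvl' : series (fun n => c n * z ^+ n) @ \oo --> l.
  by move: cvl; under eq_fun do rewrite addn0.
exists l => // N; have [l' cvN lN] := tail N.
suff -> : l = l' by [].
move: cvl'; rewrite -(cvg_shiftn N) => cvl'.
exact: (cvg_unique (@norm_hausdorff _ _) cvl' cvN).
Qed.

Lemma cvg_real_complex (R : realType) (u : nat -> R) (l : R) :
  u @ \oo --> l -> (fun n => (u n)%:C : R[i]^o) @ \oo --> (l%:C : R[i]^o).
Proof.
move=> ul; apply/cvgrPdist_lt => e e0.
have [ei re] : complex.Im e = 0 /\ 0 < complex.Re e.
  by move: e0; rewrite ltcE/= => /andP[/eqP].
have := ul => /cvgrPdist_lt/(_ _ re); apply: filterS => n hn.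
rewrite -rmorphB normc_def/= expr0n/= addr0 sqrtr_sqr.
by rewrite ltcE/= ei eqxx.
Qed.

Section CharacteristicFunction.
Context {R : realType} {T : nuclear_triple R} (b : R) (b01 : 0 < b < 1).
Variable mu : probability (dual_measurableType T) R.
Hypothesis mu_b : mittag_leffler_measure b mu.

Let c k := (Gamma (b * k%:R + 1))^-1.

Let c_le k : `|c k| <= expR 2.
Proof.
have G0 := Gamma_gt0 b01 k.
rewrite ger0_norm ?invr_ge0 ?(ltW G0)// -[leRHS]invrK -expRN lef_pV2 ?posrE ?expR_gt0//.
exact: expRN2_le_Gamma.
Qed.

Lemma mittag_leffler_real (z : R) : `|z| <= 2^-1 -> exists2 l : R,
  mittag_leffler b z%:C = l%:C &
  forall N, `|l - \sum_(j < N) c j * z ^+ j| <= 2 * expR 2 * `|z| ^+ N.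
Proof.
move=> z2; have [l cvl tail_l] := power_series_tail c_le z2.
exists l => //; rewrite /mittag_leffler.
have -> : (fun n => z%:C ^+ n / (Gamma (b * n%:R + 1))%:C : R[i]^o) = (fun n => (c n * z ^+ n)%:C).
  by apply/funext => n; rewrite rmorphM rmorphXn fmorphV mulrC.
have -> : series (fun n => (c n * z ^+ n)%:C : R[i]^o) =
    (fun n => (series (fun n => c n * z ^+ n) n)%:C : R[i]^o).
  by apply/funext => n; rewrite !seriesEnat/= rmorph_sum.
exact: (cvg_lim (@norm_hausdorff _ R[i]^o) (cvg_real_complex cvl)).
Qed.

Lemma pairingD (omega : dual_measurableType T) phi psi :
  pairing omega (phi + psi) = pairing omega phi + pairing omega psi.
Proof.
have [lin _] := set_valP omega.
by have := lin 1 phi psi; rewrite /= scale1r mul1r.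
Qed.

Lemma pairingZ (omega : dual_measurableType T) a phi :
  pairing omega (a *: phi) = a * pairing omega phi.
Proof.
have [lin _] := set_valP omega.
have p0 : pairing omega 0 = 0.
  have e : pairing omega (-1 *: 0 + 0) = -1 * pairing omega 0 + pairing omega 0 := lin (-1) 0 0.
  by rewrite scaler0 addr0 mulN1r addNr in e.
have e : pairing omega (a *: phi + 0) = a * pairing omega phi + pairing omega 0 := lin a phi 0.
by rewrite addr0 p0 addr0 in e.
Qed.

Lemma measurable_pairing phi :
  measurable_fun setT (fun omega : dual_measurableType T => pairing omega phi).
Proof.
move=> _ B mB; rewrite setTI; apply: sub_sigma_algebra.
exists 1%N, (fun=> phi), (fun=> B); split => //.
by apply/seteqP; split => [omega ? i//|omega /(_ ord0)].
Qed.

Lemma integral_cos_sin (phi : nuclear_space T) (l : R) :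
  mittag_leffler b (- (2^-1 * pairing0 phi phi))%:C = l%:C ->
  \int[mu]_omega cos (pairing omega phi) = l /\
  \int[mu]_omega sin (pairing omega phi) = 0.
Proof.
move=> ml; have := mu_b phi; rewrite ml /cintegral => -[<- im0]; split.
  by apply: eq_Rintegral => omega _; rewrite /cexp; simpc; rewrite expR0 mul1r.
by rewrite -[RHS]im0; apply: eq_Rintegral => omega _; rewrite /cexp; simpc; rewrite expR0 mul1r.
Qed.

Lemma pairing0Z (s : R) (phi : nuclear_space T) :
  pairing0 (s *: phi) (s *: phi) = s ^+ 2 * pairing0 phi phi.
Proof. by rewrite pairing0Zl pairing0C pairing0Zl mulrA. Qed.

Section OneDirection.
Variable xi : nuclear_space T.
Hypothesis int_xi : forall k, mu.-integrable setT (EFin \o (fun omega => pairing omega xi ^+ k)).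

Let h := pairing0 xi xi.

Let h0 : 0 <= h. Proof. by rewrite /h /pairing0 hdotE exprn_ge0. Qed.

Let small (s : R) : 0 < s < (h + 1)^-1 -> `|- (2^-1 * (s ^+ 2 * h))| <= 2^-1.
Proof.
move=> /andP[s0 sr]; have h1 : 0 < h + 1 by rewrite ltr_wpDl.
rewrite normrN ger0_norm ?mulr_ge0 ?exprn_ge0 ?invr_ge0 ?(ltW s0)//.
rewrite ler_piMr ?invr_ge0//.
have : s * (h + 1) < 1 by rewrite -ltr_pdivlMr// div1r.
by move=> sh; nra.
Qed.

(* the coefficients of s |-> E_b (- s^2 h / 2) as a power series in s *)
Let coef k := if odd k then 0 else c k./2 * (- (h / 2)) ^+ k./2.

Let coef_sum N s : \sum_(k < N.*2) coef k * s ^+ k =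
  \sum_(j < N) c j * (- (2^-1 * (s ^+ 2 * h))) ^+ j.
Proof.
elim: N => [|N IHN]; first by rewrite !big_ord0.
rewrite doubleS !big_ord_recr/= IHN /coef/= odd_double/= doubleK mul0r addr0; congr (_ + _).
rewrite -mulrA -muln2 mulnC exprM -exprMn; congr (_ * _ ^+ _).
by rewrite mulNr; congr (- _); field.
Qed.

Let integral_trig_small (s : R) : 0 < s < (h + 1)^-1 ->
  exists l, [/\ \int[mu]_omega cos (s * pairing omega xi) = l,
    \int[mu]_omega sin (s * pairing omega xi) = 0 &
    forall N, `|l - \sum_(k < N.*2) coef k * s ^+ k| <= 2 * expR 2 * (h / 2) ^+ N * s ^+ N.*2].
Proof.
move=> sr; have [l ml tail_l] := mittag_leffler_real (small sr).
exists l; have := integral_cos_sin (phi := s *: xi) (l := l); rewrite pairing0Z -/h.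
move=> /(_ ml)[int_cos int_sin]; split => [||N].
- by rewrite -int_cos; apply: eq_Rintegral => omega _; rewrite pairingZ.
- by rewrite -int_sin; apply: eq_Rintegral => omega _; rewrite pairingZ.
rewrite coef_sum; apply: le_trans (tail_l N) _.
have arg_ge0 : 0 <= 2^-1 * (s ^+ 2 * h) by rewrite mulr_ge0 ?invr_ge0// mulr_ge0 ?sqr_ge0.
rewrite -[leRHS]mulrA ler_wpM2l ?mulr_ge0 ?expR_ge0// normrN ger0_norm//.
rewrite -muln2 mulnC exprM -exprMn le_eqVlt; apply/orP; left; apply/eqP; congr (_ ^+ _).
by field.
Qed.

Let cos_pi_natmul k : cos (pi *+ k) = (-1) ^+ k :> R.
Proof.
elim: k => [|k IHk]; first by rewrite mulr0n cos0 expr0.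
by rewrite mulrSr cosDpi IHk exprS mulN1r.
Qed.

Let half_pi_double k : (pi / 2) *+ k.*2 = pi *+ k :> R.
Proof. by rewrite -muln2 mulnC mulrnA -[_ *+ 2]mulr_natr divfK. Qed.

Lemma moments_even k :
  \int[mu]_omega (pairing omega xi ^+ k.*2) = (k.*2)`!%:R * (h / 2) ^+ k / Gamma (b * k%:R + 1).
Proof.
have exp_cos N : exists C r, 0 < r /\ forall s, 0 < s < r ->
   `|\int[mu]_omega cos (s * pairing omega xi + 0) - \sum_(k < N.*2) coef k * s ^+ k|
   <= C * s ^+ N.*2.
  exists (2 * expR 2 * (h / 2) ^+ N), (h + 1)^-1; split; first by rewrite invr_gt0 ltr_wpDl.
  move=> s /integral_trig_small[l [int_cos _ tail_l]].
  by under eq_Rintegral do rewrite addr0; rewrite int_cos.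
have := moments_of_expansion (measurable_pairing xi) int_xi exp_cos k.*2.
rewrite /coef odd_double doubleK add0r half_pi_double cos_pi_natmul.
rewrite [(- (h / 2)) ^+ k]exprNn [c k * _]mulrCA -!mulrA => /(can_inj (signrMK k)).
have f0 : (k.*2)`!%:R != 0 :> R by rewrite pnatr_eq0 -lt0n fact_gt0.
move=> /(congr1 ( *%R (k.*2)`!%:R)); rewrite mulVKf// => ->.
by rewrite /c; ring.
Qed.

Lemma moments_odd k : \int[mu]_omega (pairing omega xi ^+ k.*2.+1) = 0.
Proof.
have exp_sin N : exists C r, 0 < r /\ forall s, 0 < s < r ->
   `|\int[mu]_omega cos (s * pairing omega xi + - (pi / 2)) - \sum_(k < N.*2) (fun=> 0) k * s ^+ k|
   <= C * s ^+ N.*2.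
  exists 0, (h + 1)^-1; split; first by rewrite invr_gt0 ltr_wpDl.
  move=> s /integral_trig_small[l [_ int_sin _]].
  rewrite big1 => [|i _]; last by rewrite mul0r.
  have -> : \int[mu]_omega cos (s * pairing omega xi + - (pi / 2)) = 0.
    rewrite -int_sin; apply: eq_Rintegral => omega _.
    by rewrite -[in LHS](cosN) opprD opprK cosDpihalf sinN opprK.
  by rewrite subr0 normr0 mul0r.
have := @moments_of_expansion _ _ _ mu _ (measurable_pairing xi) int_xi
  (- (pi / 2)) (fun=> 0) exp_sin k.*2.+1.
rewrite [(pi / 2) *+ _]mulrS addKr half_pi_double cos_pi_natmul.
move=> /eqP; rewrite !mulf_eq0 signr_eq0 invr_eq0 pnatr_eq0 -[_ == 0%N]negbK -lt0n fact_gt0/=.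
by move=> /eqP.
Qed.

End OneDirection.
End CharacteristicFunction.

(** * Polynomials in square integrable functions *)

Section SquareIntegrable.
Context d {X : measurableType d} {R : realType} (mu : probability X R).

Definition square_integrable (g : X -> R) : Prop :=
  measurable_fun setT g /\ mu.-integrable setT (EFin \o (fun x => g x ^+ 2)).

Lemma square_integrableD g1 g2 : square_integrable g1 -> square_integrable g2 ->
  square_integrable (fun x => g1 x + g2 x).
Proof.
move=> [mg1 ig1] [mg2 ig2]; split; first exact: measurable_funD.
apply: (@integrable_EFin_le _ _ _ mu setT measurableT _ (fun x => 2 * (g1 x ^+ 2 + g2 x ^+ 2))).
- by apply: measurable_funX; exact: measurable_funD.
- move=> x _; rewrite ger0_norm ?sqr_ge0//.
  by have := sqr_ge0 (g1 x - g2 x); nra.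
- by apply: integrable_EFinZ => //; exact: integrable_EFinD.
Qed.

Lemma square_integrableZ a g : square_integrable g -> square_integrable (fun x => a * g x).
Proof.
move=> [mg ig]; split; first exact: measurable_funM.
by under [X in EFin \o X]eq_fun do rewrite exprMn; exact: integrable_EFinZ.
Qed.

Lemma square_integrable_sum n (g : 'I_n -> X -> R) :
  (forall i, square_integrable (g i)) -> square_integrable (fun x => \sum_(i < n) g i x).
Proof.
move=> ig; elim: n g ig => [|n IHn] g ig.
  under [X in square_integrable X]eq_fun do rewrite big_ord0.
  split; first exact: measurable_cst.
  exact: finite_measure_integrable_cst.
under [X in square_integrable X]eq_fun do rewrite big_ord_recr.
by apply: square_integrableD => //; exact: IHn.
Qed.

Lemma ReD (z w : R[i]) : complex.Re (z + w) = complex.Re z + complex.Re w.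
Proof. by case: z w => [? ?] []. Qed.

Lemma ImD (z w : R[i]) : complex.Im (z + w) = complex.Im z + complex.Im w.
Proof. by case: z w => [? ?] []. Qed.

Lemma ReMr (z : R[i]) (a : R) : complex.Re (z * a%:C) = complex.Re z * a.
Proof. by case: z => [? ?]; simpc. Qed.

Lemma ImMr (z : R[i]) (a : R) : complex.Im (z * a%:C) = complex.Im z * a.
Proof. by case: z => [? ?]; simpc. Qed.

Lemma Re_sum (J : finType) (F : J -> R[i]) :
  complex.Re (\sum_j F j) = \sum_j complex.Re (F j).
Proof. by apply: (big_morph (@complex.Re R) ReD). Qed.

Lemma Im_sum (J : finType) (F : J -> R[i]) :
  complex.Im (\sum_j F j) = \sum_j complex.Im (F j).
Proof. by apply: (big_morph (@complex.Im R) ImD). Qed.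

Lemma L2_square_integrable_Re (f : X -> R[i]) : L2 mu f ->
  square_integrable (fun x => complex.Re (f x)).
Proof.
move=> [mre mim fin]; split => //.
have E x : complex.Re (`|f x| ^+ 2) = complex.Re (f x) ^+ 2 + complex.Im (f x) ^+ 2.
  by rewrite -add_Re2_Im2.
have m2 : measurable_fun setT (fun x => complex.Re (`|f x| ^+ 2)).
  have -> : (fun x => complex.Re (`|f x| ^+ 2)) =
      (fun x => complex.Re (f x) ^+ 2 + complex.Im (f x) ^+ 2) by apply/funext.
  by apply: measurable_funD; apply: measurable_funX.
have int2 : mu.-integrable setT (EFin \o (fun x => complex.Re (`|f x| ^+ 2))).
  apply/integrableP; split; first exact/measurable_EFinP.
  apply: le_lt_trans fin; apply: ge0_le_integral => //.
  - by apply/measurable_EFinP; exact: measurableT_comp.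
  - exact/measurable_EFinP.
  - by move=> x _; rewrite lee_fin ger0_norm// E addr_ge0 ?sqr_ge0.
apply: (@integrable_EFin_le _ _ _ mu setT measurableT _ _ _ _ int2).
  exact: measurable_funX.
by move=> x _; rewrite E ger0_norm ?sqr_ge0// lerDl sqr_ge0.
Qed.

(** As (p n) is monic, f^n is the real part of (p n)(f) minus a combination of
lower powers of f; so f^n is square integrable by induction on n. *)
Lemma integrable_powers (f : X -> R) (p : nat -> {poly R[i]}) :
  (forall n, p n \is monic) -> (forall n, size (p n) = n.+1) ->
  (forall n, L2 mu (fun x => (p n).[(f x)%:C])) ->
  forall k, mu.-integrable setT (EFin \o (fun x => f x ^+ k)).
Proof.
move=> p_monic p_size p_L2.
have sq n : square_integrable (fun x => f x ^+ n).
  elim/ltn_ind: n => n IHn.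
  have E x : f x ^+ n = complex.Re (p n).[(f x)%:C] +
      -1 * \sum_(i < n) complex.Re (p n)`_i * f x ^+ i.
    rewrite horner_coef p_size big_ord_recr/= ReD Re_sum mulN1r addrAC.
    have -> : \sum_(i < n) complex.Re ((p n)`_i * (f x)%:C ^+ i) =
              \sum_(i < n) complex.Re (p n)`_i * f x ^+ i.
      by apply: eq_bigr => i _; rewrite -rmorphXn ReMr.
    rewrite subrr add0r -rmorphXn ReMr.
    have := p_monic n; rewrite monicE lead_coefE p_size/= => /eqP ->.
    by rewrite mul1r.
  under [X in square_integrable X]eq_fun do rewrite E.
  apply: square_integrableD; first exact: L2_square_integrable_Re.
  apply: square_integrableZ; apply: square_integrable_sum => i.
  by apply: square_integrableZ; apply: IHn.
move=> k; have [mk ik] := sq k.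
apply: (@integrable_EFin_le _ _ _ mu setT measurableT _ (fun x => 1 + (f x ^+ k) ^+ 2)) => //.
  move=> x _; rewrite -[(f x ^+ k) ^+ 2]real_normK ?num_real//.
  by have := sqr_ge0 (`|f x ^+ k| - 1); have := normr_ge0 (f x ^+ k); nra.
by apply: integrable_EFinD => //; exact: finite_measure_integrable_cst.
Qed.

Variables (x y : X -> R).
Hypothesis mx : measurable_fun setT x.
Hypothesis my : measurable_fun setT y.
Hypothesis int_x : forall k, mu.-integrable setT (EFin \o (fun w => x w ^+ k)).
Hypothesis int_y : forall k, mu.-integrable setT (EFin \o (fun w => y w ^+ k)).

Lemma integrable_mixed i j : mu.-integrable setT (EFin \o (fun w => x w ^+ i * y w ^+ j)).
Proof.
apply: (@integrable_EFin_le _ _ _ mu setT measurableT _ (fun w => x w ^+ i.*2 + y w ^+ j.*2)).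
- by apply: measurable_funM; apply: measurable_funX.
- move=> w _; rewrite normrM -!muln2 !exprM.
  rewrite -[(x w ^+ i) ^+ 2]real_normK ?num_real// -[(y w ^+ j) ^+ 2]real_normK ?num_real//.
  have := sqr_ge0 (`|x w ^+ i| - `|y w ^+ j|).
  have := normr_ge0 (x w ^+ i); have := normr_ge0 (y w ^+ j); nra.
- exact: integrable_EFinD.
Qed.

Lemma cintegral_sum (J : finType) (a : J -> R[i]) (g : J -> X -> R) :
  (forall j, mu.-integrable setT (EFin \o g j)) ->
  cintegral mu (fun w => \sum_j a j * (g j w)%:C) = \sum_j a j * (\int[mu]_w g j w)%:C.
Proof.
move=> ig; rewrite /cintegral.
have int_part (c : J -> R) : \int[mu]_w (\sum_j c j * g j w) = \sum_j c j * \int[mu]_w g j w.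
  have [|_ ->] := Rintegral_sum (mu := mu) (g := fun j w => c j * g j w).
    by move=> j; exact: integrable_EFinZ.
  by apply: eq_bigr => j _; rewrite RintegralZl.
apply/eqP; rewrite eq_complex/= Re_sum Im_sum; apply/andP; split; apply/eqP.
  under eq_Rintegral do rewrite Re_sum; under eq_Rintegral do under eq_bigr do rewrite ReMr.
  by rewrite int_part; apply: eq_bigr => j _; rewrite ReMr.
under eq_Rintegral do rewrite Im_sum; under eq_Rintegral do under eq_bigr do rewrite ImMr.
by rewrite int_part; apply: eq_bigr => j _; rewrite ImMr.
Qed.

(** This turns orthogonality into linear algebra: the inner product is a
function of the mixed moments alone. *)
Lemma L2_inner_poly (p q : {poly R[i]}) :
  L2_inner mu (fun w => p.[(x w)%:C]) (fun w => q.[(y w)%:C]) =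
  \sum_(i < size p) p`_i *
    \sum_(j < size q) (q`_j)^* * (\int[mu]_w (x w ^+ i * y w ^+ j))%:C.
Proof.
rewrite /L2_inner.
have -> : (fun w => p.[(x w)%:C] * (q.[(y w)%:C])^*) =
   (fun w => \sum_(ij : 'I_(size p) * 'I_(size q))
       p`_ij.1 * (q`_ij.2)^* * (x w ^+ ij.1 * y w ^+ ij.2)%:C).
  apply/funext => w; rewrite -(pair_bigA _ (fun (i : 'I_(size p)) (j : 'I_(size q)) =>
     p`_i * (q`_j)^* * (x w ^+ i * y w ^+ j)%:C))/=.
  rewrite !horner_coef rmorph_sum mulr_suml; apply: eq_bigr => i _.
  rewrite mulr_sumr; apply: eq_bigr => j _.
  have yw_real : Num.conj ((y w)%:C : R[i]) = (y w)%:C by exact: conjc_real.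
  by rewrite !rmorphM !rmorphXn/= yw_real; exact: mulrACA.
rewrite (@cintegral_sum ('I_(size p) * 'I_(size q))%type
  (fun ij => p`_ij.1 * (q`_ij.2)^*) (fun ij w => x w ^+ ij.1 * y w ^+ ij.2)).
  rewrite -(pair_bigA _ (fun (i : 'I_(size p)) (j : 'I_(size q)) =>
     p`_i * (q`_j)^* * (\int[mu]_w (x w ^+ i * y w ^+ j))%:C))/=.
  by apply: eq_bigr => i _; rewrite mulr_sumr; apply: eq_bigr => j _; rewrite mulrA.
by move=> ij; exact: integrable_mixed.
Qed.

End SquareIntegrable.

(** The step of the elimination for a monic family: a linear functional that
kills a monic polynomial of degree n and the powers X^j with j < n also kills
X^n.  It is applied to the weights w j, the values of the functional at X^j. *)
Lemma last_weight_eq0 (F : pzRingType) (a w : nat -> F) (n : nat) :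
  a n = 1 -> \sum_(j < n.+1) a j * w j = 0 -> (forall j, (j < n)%N -> w j = 0) -> w n = 0.
Proof.
move=> an + w0; rewrite big_ord_recr/= an mul1r big1 ?add0r// => j _.
by rewrite w0// mulr0.
Qed.

Lemma coef_sqrX_add1_exp (R : nzRingType) k :
  [/\ (('X^2 + 1) ^+ k : {poly R})`_0 = 1, (('X^2 + 1) ^+ k : {poly R})`_1 = 0 &
      (('X^2 + 1) ^+ k : {poly R})`_2 = k%:R].
Proof.
elim: k => [|k [IH0 IH1 IH2]]; first by rewrite expr0 !coef1.
rewrite exprS mulrDl mul1r !coefD !coefXnM/= IH0 IH1 IH2 !add0r.
by split => //; rewrite -natr1 addrC.
Qed.

(** * Two orthonormal directions *)

Section Pair.
Context {R : realType} {T : nuclear_triple R} (b : R) (b01 : 0 < b < 1).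
Variable mu : probability (dual_measurableType T) R.
Hypothesis mu_b : mittag_leffler_measure b mu.
Hypothesis int_pow : forall (xi : nuclear_space T) k,
  mu.-integrable setT (EFin \o (fun omega => pairing omega xi ^+ k)).
Variables xi zeta : nuclear_space T.
Hypothesis xi1 : pairing0 xi xi = 1.
Hypothesis zeta1 : pairing0 zeta zeta = 1.
Hypothesis xi_zeta : pairing0 xi zeta = 0.

Let x (omega : dual_measurableType T) := pairing omega xi.
Let y (omega : dual_measurableType T) := pairing omega zeta.
Let m i j := \int[mu]_w (x w ^+ i * y w ^+ j).
Let M k := \int[mu]_w (y w ^+ k).

Let int_m i j : mu.-integrable setT (EFin \o (fun w => x w ^+ i * y w ^+ j)).
Proof.
exact: (integrable_mixed (measurable_pairing xi) (measurable_pairing zeta)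
  (int_pow xi) (int_pow zeta)).
Qed.

Lemma pairing0_line a : pairing0 (a *: xi + zeta) (a *: xi + zeta) = a ^+ 2 + 1.
Proof.
rewrite pairing0Dl ![pairing0 _ (_ + _)]pairing0C !pairing0Dl !pairing0Zl.
rewrite ![pairing0 _ (_ *: _)]pairing0C !pairing0Zl ?[pairing0 zeta xi]pairing0C.
by rewrite xi1 zeta1 xi_zeta; ring.
Qed.

Lemma moment_line n a :
  \int[mu]_omega (pairing omega (a *: xi + zeta) ^+ n) =
  \sum_(i < n.+1) 'C(n, i)%:R * m i (n - i) * a ^+ i.
Proof.
have -> : (fun omega => pairing omega (a *: xi + zeta) ^+ n) =
    (fun w => \sum_(i < n.+1) ('C(n, i)%:R * a ^+ i) * (x w ^+ i * y w ^+ (n - i))).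
  apply/funext => w; rewrite pairingD pairingZ addrC exprDn; apply: eq_bigr => i _.
  by rewrite exprMn -mulr_natl -/(x w) -/(y w); ring.
have [|_ ->] := Rintegral_sum (mu := mu)
    (g := fun (i : 'I_n.+1) w => ('C(n, i)%:R * a ^+ i) * (x w ^+ i * y w ^+ (n - i))).
  by move=> i; exact: integrable_EFinZ.
by apply: eq_bigr => i _; rewrite RintegralZl// mulrAC.
Qed.

(** By [moments_even] the moment of order n = 2k + 2 of a xi + zeta is
(a^2 + 1)^(k+1) times that of zeta.  Both sides are polynomials in a; compare
the coefficients of a^2, namely C(n, 2) m 2 (n - 2) and (k + 1) M n. *)
Lemma mixed_moment k : m 2 k.*2 = M k.+1.*2 / k.*2.+1%:R.
Proof.
pose n := k.+1.*2.
pose p : {poly R} := \poly_(i < n.+1) ('C(n, i)%:R * m i (n - i)).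
pose q : {poly R} := M n *: (('X^2 + 1) ^+ k.+1).
have pq : p = q.
  apply/eqP; rewrite -subr_eq0; apply/eqP.
  (* with the constant 0, smallness at 0 is just the vanishing of p - q *)
  apply: (@poly_bigO_eq0 _ _ _ 0 1 (leqnn _)) => // a _.
  rewrite mul0r hornerD hornerN hornerZ horner_exp !hornerE horner_poly.
  rewrite -moment_line /M /n !(moments_even b01 mu_b)// pairing0_line zeta1.
  rewrite normr_le0 subr_eq0; apply/eqP.
  by rewrite exprMn mul1r; ring.
have := congr1 (fun r : {poly R} => r`_2) pq.
have [_ _ c2] := coef_sqrX_add1_exp R k.+1.
rewrite coef_poly coefZ c2 /n doubleS /= !subSS subn0.
have binE : 'C(k.*2.+2, 2) = (k.+1 * k.*2.+1)%N.
  by rewrite bin2 succnK -doubleS -doubleMl doubleK.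
rewrite binE natrM => e.
have k1 : k.+1%:R != 0 :> R by rewrite pnatr_eq0.
have k2 : k.*2.+1%:R != 0 :> R by rewrite pnatr_eq0.
have {}e : k.*2.+1%:R * m 2 k.*2 = M k.+1.*2.
  by apply: (mulfI k1); rewrite mulrA e mulrC.
by rewrite -e mulrC mulKf.
Qed.

Lemma mixed_moment21 : m 2 1 = 0.
Proof.
have odd3 a := moment_line 3 a.
have Z a : \int[mu]_omega (pairing omega (a *: xi + zeta) ^+ 3) = 0.
  exact: (moments_odd b01 mu_b (int_pow _) 1).
(* E (a x + y)^3 = 0 at a = 1, -1, 0 isolates the coefficient of a^2 *)
have := odd3 1; have := odd3 (-1); have := odd3 0; rewrite !Z !big_ord_recr !big_ord0/=.
rewrite !subSS !subn0 !bin0 !bin1 !binn.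
rewrite (_ : 'C(3, 2) = 3%N)//.
move: (m 0 3) (m 1 2) (m 2 1) (m 3 0) => p q r s e0 eN e1; lra.
Qed.

Let Mx k : \int[mu]_w (x w ^+ k.*2) = M k.*2.
Proof. by rewrite /M !(moments_even b01 mu_b)// xi1 zeta1. Qed.

(** The Cauchy-Schwarz inequality for y^2 alone would not be strict.  Instead,
expand E (x^2 + y^2 - M 2)^2 >= 0 with E x^2 y^2 = M 4 / 3: this gives
(8 / 3) M 4 >= 3 (M 2)^2. *)
Lemma sqr_moment2_lt_moment4 : M 2 ^+ 2 < M 4.
Proof.
have M2 : 0 < M 2.
  rewrite /M (moments_even b01 mu_b (int_pow _) 1) zeta1.
  by rewrite divr_gt0 ?(Gamma_gt0 b01)// mulr_gt0 ?expr1 ?divr_gt0.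
have m22 : m 2 2 = M 4 / 3%:R := mixed_moment 1.
have Mx2 : \int[mu]_w (x w ^+ 2) = M 2 := Mx 1.
have Mx4 : \int[mu]_w (x w ^+ 4) = M 4 := Mx 2.
have int1 : mu.-integrable setT (EFin \o (fun w => x w ^+ 4 + y w ^+ 4)).
  by apply: integrable_EFinD => //; exact: int_pow.
have int2 : mu.-integrable setT (EFin \o (fun w => x w ^+ 2 + y w ^+ 2)).
  by apply: integrable_EFinD => //; exact: int_pow.
have int3 : mu.-integrable setT (EFin \o (fun w => 2 * (x w ^+ 2 * y w ^+ 2))).
  exact: integrable_EFinZ.
have int4 : mu.-integrable setT (EFin \o (fun w => - (2 * M 2) * (x w ^+ 2 + y w ^+ 2))).
  exact: integrable_EFinZ.
have int5 : mu.-integrable setT (EFin \o (fun w : dual_measurableType T => M 2 ^+ 2)).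
  exact: finite_measure_integrable_cst.
have int45 := integrable_EFinD measurableT int4 int5.
have int345 := integrable_EFinD measurableT int3 int45.
have := @Rintegral_ge0 _ _ _ mu setT
  (fun w => (x w ^+ 2 + y w ^+ 2 - M 2) ^+ 2) (fun w _ => sqr_ge0 _).
have -> : (fun w => (x w ^+ 2 + y w ^+ 2 - M 2) ^+ 2) = (fun w => (x w ^+ 4 + y w ^+ 4) +
    (2 * (x w ^+ 2 * y w ^+ 2) + (- (2 * M 2) * (x w ^+ 2 + y w ^+ 2) + M 2 ^+ 2))).
  by apply/funext => w; ring.
rewrite (RintegralD measurableT int1 int345) (RintegralD measurableT int3 int45).
rewrite (RintegralD measurableT int4 int5) (RintegralZl _ measurableT (int_m 2 2)).
rewrite (RintegralZl _ measurableT int2).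
rewrite !(RintegralD measurableT (int_pow _ _) (int_pow _ _)).
rewrite Rintegral_probability_cst Mx2 Mx4 -!/(M _) -/(m 2 2) m22.
by nra.
Qed.

Lemma moment_regression_fails (al ga : R) :
  ~ (forall k, m 2 k.*2 = al * M k.*2 + ga * M k.*2.+2).
Proof.
move=> reg; apply: (@no_moment_recursion R b (fun k => M k.*2) al ga b01).
- move=> k; rewrite /M (moments_even b01 mu_b)// zeta1 expr_div_n expr1n.
  by rewrite mul1r invfM mulrA.
- rewrite /M double0; under eq_Rintegral do rewrite expr0.
  exact: Rintegral_probability_cst.
- exact: sqr_moment2_lt_moment4.
- by move=> k; rewrite -mixed_moment reg doubleS.
Qed.

End Pair.

Theorem theorem3p8 (R : realType) (T : nuclear_triple R)
    (dim_H : dim_ge2 (hsp T 0%N))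
    (beta : R) (beta01 : 0 < beta < 1)
    (mu : probability (dual_measurableType T) R)
    (mu_beta : mittag_leffler_measure beta mu)
    (I : nuclear_space T -> nat -> dual_measurableType T -> R[i])
    (I_system : forall xi, monic_orthogonal_system mu xi (I xi)) :
  exists (n m : nat) (xi zeta : nuclear_space T),
    n <> m /\ ~ L2_orthogonal mu (I xi n) (I zeta m).
Proof.
apply: contrapT => all_orth.
have orth n m xi zeta : n <> m -> L2_orthogonal mu (I xi n) (I zeta m).
  by move=> nm; apply: contrapT => no; apply: all_orth; exists n, m, xi, zeta.
have {all_orth} polyI xi : exists p : nat -> {poly R[i]},
    [/\ forall n, p n \is monic, forall n, size (p n) = n.+1 &
        forall n, I xi n = fun omega => (p n).[(pairing omega xi)%:C]].
  have [Ip _ _] := I_system xi.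
  by have [p pP] := choice Ip; exists p; split=> n; have [] := pP n.
have int_pow xi k : mu.-integrable setT (EFin \o (fun omega => pairing omega xi ^+ k)).
  have [p [p_monic p_size pE]] := polyI xi.
  have [_ IL2 _] := I_system xi.
  apply: (integrable_powers p_monic p_size) => n.
  by have := IL2 n; rewrite pE.
have [xi [zeta [xi1 zeta1 xi_zeta]]] := exists_orthonormal_pair dim_H.
have [p [p_monic p_size pE]] := polyI xi.
have [q [q_monic q_size qE]] := polyI zeta.
pose x (omega : dual_measurableType T) := pairing omega xi.
pose y (omega : dual_measurableType T) := pairing omega zeta.
pose m i j := \int[mu]_w (x w ^+ i * y w ^+ j).
pose M k := \int[mu]_w (y w ^+ k).
have monic1 (r : {poly R[i]}) n : r \is monic -> size r = n.+1 -> r`_n = 1.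
  by move=> + sr; rewrite monicE lead_coefE sr => /eqP.
(* W g i j is the inner product of the i-th power of one direction with
   I_j(zeta), when g holds the mixed moments. *)
pose W (g : nat -> nat -> R) i j := \sum_(l < j.+1) ((q j)`_l)^* * (g i l)%:C.
(* The i-th power of <w, eta> is a combination of I_0, ..., I_i in the
   direction eta, all orthogonal to I_j(zeta) as i < j. *)
have kill eta (r : nat -> {poly R[i]}) :
    (forall n, r n \is monic) -> (forall n, size (r n) = n.+1) ->
    (forall n, I eta n = fun omega => (r n).[(pairing omega eta)%:C]) ->
    forall j i, (i < j)%N ->
    W (fun i l => \int[mu]_w (pairing w eta ^+ i * y w ^+ l)) i j = 0.
  move=> r_monic r_size rE j; elim/ltn_ind => i IHi ij.
  apply: (@last_weight_eq0 _ (fun l => (r i)`_l) (fun i => W _ i j)).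
  - exact: monic1.
  - have : L2_orthogonal mu (I eta i) (I zeta j) by apply: orth => ij'; rewrite ij' ltnn in ij.
    rewrite /L2_orthogonal rE qE.
    rewrite (L2_inner_poly (measurable_pairing eta) (measurable_pairing zeta)
      (int_pow eta) (int_pow zeta)).
    by rewrite r_size q_size.
  - by move=> l li; apply: IHi => //; exact: ltn_trans ij.
have M0 : M 0%N = 1.
  rewrite /M; under eq_Rintegral do rewrite expr0.
  exact: Rintegral_probability_cst.
have M24 := sqr_moment2_lt_moment4 beta01 mu_beta int_pow xi1 zeta1 xi_zeta.
rewrite -!/(M _) in M24.
have m2E k : m 2%N k.*2 = M k.+1.*2 / k.*2.+1%:R.
  exact: (mixed_moment beta01 mu_beta).
(* al and ga solve the equations w 0 = 0 and w 2 = 0, that is, al + ga y^2 is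
   the projection of x^2; the determinant of the system is M 4 - (M 2)^2. *)
pose ga := (M 4 / 3 - M 2 ^+ 2) / (M 4 - M 2 ^+ 2).
pose al := M 2 * (1 - ga).
pose w l := m 2 l - (al * M l + ga * M (2 + l)%N).
suff w0 l : w l = 0.
  apply: (moment_regression_fails beta01 mu_beta int_pow xi1 zeta1 xi_zeta (al := al) (ga := ga)).
  by move=> k; have /eqP := w0 k.*2; rewrite /w subr_eq0 => /eqP.
have M_odd k : M k.*2.+1 = 0 by exact: (moments_odd beta01 mu_beta).
(* For l >= 3 the functional y^l |-> w l kills I_l(zeta), because x^2, 1 and y^2
   are all orthogonal to it. *)
elim/ltn_ind: l => l IHl.
have [l3|] := ltnP 2 l; last first.
  case: l {IHl} => [|[|[|//]]] _; rewrite /w.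
  - by rewrite (m2E 0%N) M0 /al addn0 divr1; ring.
  - have -> : m 2%N 1%N = 0 by exact: (mixed_moment21 beta01 mu_beta).
    by rewrite (M_odd 0%N) (M_odd 1%N) !mulr0 addr0 subrr.
  - have -> : m 2%N 2%N = M 4 / 3 := m2E 1%N.
    rewrite /al /ga; have D0 : M 4 - M 2 ^+ 2 != 0 by rewrite subr_eq0 gt_eqF.
    by rewrite (_ : M (2 + 2)%N = M 4)//; field.
apply: complexI.
apply: (@last_weight_eq0 _ (fun j => ((q l)`_j)^*) (fun j => (w j)%:C)).
- by rewrite (monic1 _ l)// conjc1.
- have W1 := kill xi p p_monic p_size pE l 2%N l3.
  have W2 := kill zeta q q_monic q_size qE l 2%N l3.
  have W3 := kill zeta q q_monic q_size qE l 0%N (ltn_trans (ltn0Sn 1) l3).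
  transitivity (W m 2%N l - (al%:C * W (fun i l => M (i + l)%N) 0%N l +
      ga%:C * W (fun i l => M (i + l)%N) 2%N l)).
    rewrite /W !mulr_sumr -big_split -sumrB/=; apply: eq_bigr => j _.
    by rewrite /w rmorphB rmorphD !rmorphM/= add0n; ring.
  have WM i : W (fun i l => M (i + l)%N) i l =
      W (fun i l => \int[mu]_w (pairing w zeta ^+ i * y w ^+ l)) i l.
    apply: eq_bigr => j _; congr (_ * _%:C); apply: eq_Rintegral => v _.
    by rewrite exprD.
  by rewrite !WM W2 W3 [W m _ _]W1 !mulr0 addr0 subrr.
- by move=> j jl; rewrite IHl.
Qed.
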